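(* Let $\alpha>0$ and let $\psi\in C^0([-1,1];(0,\infty))$ satisfy $\psi(1)=\psi(-1)>\alpha$ and $\psi(x)=\psi(-x)$ for all $x\in(-1,1)$. Assume that $$\inf_{v\in N_\alpha(\psi)}W(v)<\pi\max_{S\in[0,\alpha]}g_\alpha(S),\qquad g_\alpha(S):=(\alpha-S)\,G(S)^2 .$$ Then there exists $u\in N_\alpha(\psi)$ such that $$W(u)=\inf_{v\in N_\alpha(\psi)}W(v).$$
   Context: The admissible sets are $$N_\alpha=\{v\in H^2((-1,1);(0,\infty))\mid v(1)=v(-1)=\alpha,\ v'(1)=v'(-1)=0,\ v(x)=v(-x)\ \text{for all }x\in[-1,1]\},$$ $$N_\alpha(\psi)=\{v\in N_\alpha\mid v(x)\le\psi(x)\ \text{for all }x\in[-1,1]\}.$$ The Willmore functional of the surface of revolution obtained by rotating the graph of $v$ around the $x$-axis is $$W(v)=\frac{\pi}{2}\int_{-1}^1\left(\frac{1}{v(x)\sqrt{1+v'(x)^2}}-\frac{v''(x)}{(1+v'(x)^2)^{3/2}}\right)^2v(x)\sqrt{1+v'(x)^2}\,dx .$$ The function $G$ is $G(t)=\int_0^t\frac{d\tau}{(1+\tau^2)^{5/4}}$ for $t\in\mathbb R$. *)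

(* Defs.v *)
From HB Require Import structures.
From mathcomp Require Import all_boot all_order all_algebra.
From mathcomp Require Import all_classical all_reals all_analysis.

Set Implicit Arguments.
Unset Strict Implicit.
Unset Printing Implicit Defensive.

Import Order.TTheory GRing.Theory Num.Theory.
Import numFieldNormedType.Exports.
Local Open Scope classical_set_scope.
Local Open Scope ring_scope.

(* C^1_c(-1,1). The closed support is bounded, so its inclusion in the open
   interval already makes it a compact subset of it. *)
Definition test_function (R : realType) (phi : R -> R) : Prop :=
  [/\ forall x, derivable phi x 1,
      continuous (derive1 phi)
    & closure [set x | phi x != 0] `<=` `]-1, 1[ ].

(* Weak derivatives on (-1,1), tested against C^1_c as in H. Brezis,
   Functional Analysis, Sobolev Spaces and PDE, Section 8.2. *)
Definition weak_derivative (R : realType) (f g : R -> R) : Prop :=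
  forall phi : R -> R, test_function phi ->
    \int[@lebesgue_measure R]_(x in `]-1, 1[) (f x * derive1 phi x) =
    - \int[@lebesgue_measure R]_(x in `]-1, 1[) (g x * phi x).

Definition L2 (R : realType) (f : R -> R) : Prop :=
  measurable_fun (`]-1, 1[ : set R) f /\
  (@lebesgue_measure R).-integrable `]-1, 1[ (fun x => (f x ^+ 2)%:E).

(* H^2(-1,1). An element is given by its C^1([-1,1]) representative [H2_fun],
   the continuous representative [H2_d1] of v' up to the boundary (so that
   v(-1), v(1), v'(-1), v'(1) are meaningful), and a version [H2_d2] of the weak
   second derivative, which is determined only almost everywhere. Values
   outside [-1,1] are irrelevant. *)
Record H2 (R : realType) := MkH2 {
  H2_fun :> R -> R;
  H2_d1 : R -> R;
  H2_d2 : R -> R;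
  H2_fun_cont : {within `[-1, 1], continuous H2_fun};
  H2_d1_cont : {within `[-1, 1], continuous H2_d1};
  H2_fun_L2 : L2 H2_fun;
  H2_d1_L2 : L2 H2_d1;
  H2_d2_L2 : L2 H2_d2;
  H2_fun_weak : weak_derivative H2_fun H2_d1;
  H2_d1_weak : weak_derivative H2_d1 H2_d2
}.

Definition admissible (R : realType) (alpha : R) : set (H2 R) :=
  [set v : H2 R | [/\ forall x : R, x \in `]-1, 1[ -> 0 < v x,
               v 1 = alpha /\ v (-1) = alpha,
               H2_d1 v 1 = 0 /\ H2_d1 v (-1) = 0
             & forall x : R, x \in `[-1, 1] -> v x = v (- x)]].

Definition admissible_obstacle (R : realType) (alpha : R) (psi : R -> R) :
    set (H2 R) :=
  [set v : H2 R | admissible alpha v /\ forall x : R, x \in `[-1, 1] -> v x <= psi x].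

Definition Willmore (R : realType) (v : H2 R) : \bar R :=
  ((pi / 2)%:E * \int[@lebesgue_measure R]_(x in `](-1)%R, 1%R[)
     ((1 / (v x * Num.sqrt (1 + H2_d1 v x ^+ 2))
       - H2_d2 v x / (1 + H2_d1 v x ^+ 2) `^ (3 / 2)) ^+ 2
      * v x * Num.sqrt (1 + H2_d1 v x ^+ 2))%:E)%E.

(* The integral from 0 to t, with the usual sign convention for t < 0. *)
Definition G (R : realType) (t : R) : R :=
  let f (tau : R) := 1 / (1 + tau ^+ 2) `^ (5 / 4) in
  if 0 <= t then \int[@lebesgue_measure R]_(tau in `[0, t]) f tau
  else - \int[@lebesgue_measure R]_(tau in `[t, 0]) f tau.

Definition g (R : realType) (alpha S : R) : R := (alpha - S) * G S ^+ 2.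

Definition is_max (R : realType) (A : set R) (M : R) : Prop :=
  A M /\ ubound A M.

(* Main.v *)
(* Expanding the square, the mixed term of W(v) integrates to zero because v'
   vanishes at both ends, so W(v) = (pi/2) * int k(v')^2 / v + v k(v')^10 v''^2
   with k(p) = kappa p = (1 + p^2)^(-1/4). If |v'| reached the value S maximizing
   g_alpha, then up to the first such point v >= alpha - S, and the
   Cauchy-Schwarz inequality applied to (G(v'))' = k(v')^5 v'' there and on the
   mirror interval would give W(v) >= pi g_alpha(S). Along a minimizing sequence
   |v'| <= S, hence v >= alpha - S > 0 and v'' is bounded in L^2, and Ascoli's
   theorem makes v and v' converge uniformly. No weak compactness is needed:
   the admissible set is convex, so the midpoint of two almost minimizers that
   are close in C^1 has almost at least their energy, and the parallelogram
   identity in v'' forces the sequence v'' to be Cauchy in L^2. *)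
Require Import Defs.
From HB Require Import structures.
From mathcomp Require Import all_boot all_order all_algebra.
From mathcomp Require Import all_classical all_reals all_analysis.
From mathcomp Require Import measurable_realfun ring lra.

Set Implicit Arguments.
Unset Strict Implicit.
Unset Printing Implicit Defensive.

Import Order.TTheory GRing.Theory Num.Theory.
Import numFieldNormedType.Exports.
Local Open Scope classical_set_scope.
Local Open Scope ring_scope.

(** * The integrand *)

(** The analytic obstacle is a chain rule for $F(v')$ with $F'=k^n$, starting from weak derivatives
    alone. Its engine is one remark: a defect that is additive in the interval $[s,t]$ and bounded
    by $C(t-s)\int_s^t q^2$ vanishes. Lipschitz estimates and Cauchy-Schwarz supply such bounds, so
    differentiation almost everywhere never enters.

    The threshold $\pi\max g_\alpha$ is the cost of two mirror intervals: each has length at most 1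
    and contributes at least $(\alpha-S)G(S)^2$, and $2\cdot\pi/2=\pi$. The strict inequality in the
    hypothesis is used twice: for the slope bound, and for $S<\alpha$, because $g_\alpha(\alpha)=0$
    while energies are nonnegative.

    Uniform limits are taken along an ultrafilter of near-minimizers; a sequence is drawn only
    afterwards, with all errors at most $8^{-k}$. At this rate the second derivatives converge
    almost everywhere under an integrable majorant, so weak derivatives pass to the limit by
    dominated convergence and the energy by Fatou's lemma. *)

Section kappa.
Context {R : realType}.
Implicit Types a b p q t v w S : R.

(** The exponent $-1/4$ makes every fractional power of the problem an integer power:
    $\sqrt{1+p^2}=k^{-2}$, $(1+p^2)^{3/2}=k^{-6}$, and the integrand of $G$ is $k^5$. Identities
    become [field] goals, and Lipschitz bounds an induction on the power. *)
Definition kappa p : R := (1 + p ^+ 2) `^ (- (1 / 4)).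

Let sq1_gt0 p : 0 < 1 + p ^+ 2.
Proof. by rewrite ltr_pwDl// sqr_ge0. Qed.

Lemma kappaX p n : kappa p ^+ n = (1 + p ^+ 2) `^ (- (n%:R / 4)).
Proof.
rewrite -powR_mulrn ?powR_ge0// -powRrM; congr (_ `^ _).
by field.
Qed.

Lemma kappa_gt0 p : 0 < kappa p.
Proof. by rewrite powR_gt0. Qed.

Lemma kappa_ge0 p : 0 <= kappa p.
Proof. exact/ltW/kappa_gt0. Qed.

Lemma kappa4 p : kappa p ^+ 4 = (1 + p ^+ 2)^-1.
Proof. by rewrite kappaX divff// powR_inv1// ltW. Qed.

Lemma kappa_le p q : `|p| <= `|q| -> kappa q <= kappa p.
Proof.
move=> pq; rewrite -(@ler_pXn2r _ 4)// ?nnegrE ?kappa_ge0// !kappa4.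
rewrite lef_pV2 ?posrE// lerD2l -(ger0_norm (sqr_ge0 p)) -(ger0_norm (sqr_ge0 q)).
by rewrite !normrX lerXn2r ?nnegrE.
Qed.

Lemma kappa_le1 p : kappa p <= 1.
Proof.
apply: (le_trans (@kappa_le 0 p _)); first by rewrite normr0.
by rewrite /kappa expr0n addr0 powR1.
Qed.

(** From $k^4(1+p^2)=1$ one gets $x^4-y^4=x^4y^4(b^2-a^2)$. Dividing by $(x+y)(x^2+y^2)$ leaves
    $|a-b|$ times a factor that is at most 1, since $x^2|a|\le1$, $y^2|b|\le1$ and $x,y\le1$. *)
Lemma kappa_lipschitz a b : `|kappa a - kappa b| <= `|a - b|.
Proof.
set x := kappa a; set y := kappa b.
have x0 : 0 < x := kappa_gt0 a; have y0 : 0 < y := kappa_gt0 b.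
have x1 : x <= 1 := kappa_le1 a; have y1 : y <= 1 := kappa_le1 b.
have xE : x ^+ 4 * (1 + a ^+ 2) = 1 by rewrite kappa4 mulVf// gt_eqF.
have yE : y ^+ 4 * (1 + b ^+ 2) = 1 by rewrite kappa4 mulVf// gt_eqF.
have x2a : x ^+ 2 * `|a| <= 1.
  rewrite -(@ler_pXn2r _ 2)// ?nnegrE ?(mulr_ge0 (sqr_ge0 x))// exprMn -exprM expr1n.
  by rewrite real_normK ?num_real// -xE ler_pM2l ?exprn_gt0// lerDr.
have y2b : y ^+ 2 * `|b| <= 1.
  rewrite -(@ler_pXn2r _ 2)// ?nnegrE ?(mulr_ge0 (sqr_ge0 y))// exprMn -exprM expr1n.
  by rewrite real_normK ?num_real// -yE ler_pM2l ?exprn_gt0// lerDr.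
have key : (x - y) * ((x + y) * (x ^+ 2 + y ^+ 2)) =
    x ^+ 4 * y ^+ 4 * ((b - a) * (a + b)).
  have -> : x ^+ 4 * y ^+ 4 * ((b - a) * (a + b)) =
    x ^+ 4 * (y ^+ 4 * (1 + b ^+ 2)) - y ^+ 4 * (x ^+ 4 * (1 + a ^+ 2)) by ring.
  by rewrite xE yE; ring.
have s0 : 0 < (x + y) * (x ^+ 2 + y ^+ 2).
  by rewrite mulr_gt0 ?addr_gt0 ?exprn_gt0.
have xy0 : 0 <= x ^+ 4 * y ^+ 4 by rewrite mulr_ge0// exprn_ge0 ?ltW.
rewrite -(ler_pM2r s0).
have -> : `|x - y| * ((x + y) * (x ^+ 2 + y ^+ 2)) = `|a - b| * (x ^+ 4 * y ^+ 4 * `|a + b|).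
  rewrite -{1}(gtr0_norm s0) -normrM key normrM (ger0_norm xy0) normrM (distrC b).
  by rewrite mulrCA.
rewrite ler_wpM2l//.
apply: (@le_trans _ _ (x ^+ 4 * y ^+ 4 * (`|a| + `|b|))).
  by rewrite ler_wpM2l// ler_normD.
have step (t : R) : 0 < t -> t <= 1 -> t ^+ 4 <= t.
  by move=> t0 t1; rewrite exprS ler_piMr ?(ltW t0)// exprn_ile1// ltW.
have h1 : x ^+ 4 * y ^+ 4 * `|a| <= x ^+ 2 * (x + y).
  have -> : x ^+ 4 * y ^+ 4 * `|a| = (x ^+ 2 * `|a|) * (x ^+ 2 * y ^+ 4) by ring.
  apply: (@le_trans _ _ (1 * (x ^+ 2 * y ^+ 4))).
    by rewrite ler_wpM2r// mulr_ge0// exprn_ge0// ltW.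
  rewrite mul1r ler_wpM2l ?sqr_ge0//.
  apply: (@le_trans _ _ y); last by rewrite lerDr ltW.
  exact: step.
have h2 : x ^+ 4 * y ^+ 4 * `|b| <= y ^+ 2 * (x + y).
  have -> : x ^+ 4 * y ^+ 4 * `|b| = (y ^+ 2 * `|b|) * (y ^+ 2 * x ^+ 4) by ring.
  apply: (@le_trans _ _ (1 * (y ^+ 2 * x ^+ 4))).
    by rewrite ler_wpM2r// mulr_ge0// exprn_ge0// ltW.
  rewrite mul1r ler_wpM2l ?sqr_ge0//.
  apply: (@le_trans _ _ x); last by rewrite lerDl ltW.
  exact: step.
lra.
Qed.

Lemma kappaX_ge0 p n : 0 <= kappa p ^+ n.
Proof. by rewrite exprn_ge0 ?kappa_ge0. Qed.

Lemma kappaX_le1 p n : kappa p ^+ n <= 1.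
Proof. by rewrite exprn_ile1 ?kappa_ge0 ?kappa_le1. Qed.

Lemma kappaX_lipschitz n a b : `|kappa a ^+ n - kappa b ^+ n| <= n%:R * `|a - b|.
Proof.
elim: n => [|n ih]; first by rewrite !expr0 subrr normr0 mul0r.
have -> : kappa a ^+ n.+1 - kappa b ^+ n.+1 =
    kappa a * (kappa a ^+ n - kappa b ^+ n) + kappa b ^+ n * (kappa a - kappa b).
  by rewrite !exprS; ring.
rewrite (le_trans (ler_normD _ _))// -natr1 mulrDl mul1r !normrM lerD//.
  rewrite (le_trans _ ih)// ler_piMl// ger0_norm ?kappa_ge0 ?kappa_le1//.
rewrite (le_trans _ (kappa_lipschitz a b))// ler_piMl// ger0_norm ?kappaX_ge0 ?kappaX_le1//.
Qed.

Lemma kappa_continuous : continuous kappa.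
Proof.
move=> p; apply/cvgrPdist_lt => e e0; near=> q.
apply: le_lt_trans (kappa_lipschitz _ _) _.
by near: q; exact: cvgr_dist_lt.
Unshelve. all: by end_near. Qed.

(** In the mixed term the factors $v$ and $1/v$ cancel; what is left, $k(p)^6q$, involves only $v'$
    and $v''$ and is therefore an exact derivative. *)
Lemma willmore_integrandE v p q : 0 < v ->
  (1 / (v * Num.sqrt (1 + p ^+ 2)) - q / (1 + p ^+ 2) `^ (3 / 2)) ^+ 2
    * v * Num.sqrt (1 + p ^+ 2) =
  (kappa p ^+ 2 / v + v * kappa p ^+ 10 * q ^+ 2) - 2 * (kappa p ^+ 6 * q).
Proof.
move=> v0; set k := kappa p; have k0 : 0 < k := kappa_gt0 p.
have -> : Num.sqrt (1 + p ^+ 2) = (k ^+ 2)^-1.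
  by rewrite kappaX powRN invrK -powR12_sqrt ?(ltW (sq1_gt0 p))//; congr (_ `^ _); field.
have -> : (1 + p ^+ 2) `^ (3 / 2) = (k ^+ 6)^-1.
  by rewrite kappaX powRN invrK; congr (_ `^ _); field.
by field; rewrite !gt_eqF.
Qed.

Lemma G_integrandE t : 1 / (1 + t ^+ 2) `^ (5 / 4) = kappa t ^+ 5.
Proof. by rewrite kappaX powRN div1r; congr (_ `^ _)^-1. Qed.

Definition edensity v p q : R := kappa p ^+ 2 / v + v * kappa p ^+ 10 * q ^+ 2.

Lemma edensity_ge0 v p q : 0 <= v -> 0 <= edensity v p q.
Proof.
move=> v0; apply: addr_ge0; first by rewrite divr_ge0// kappaX_ge0.
by apply: mulr_ge0; [apply: mulr_ge0; rewrite ?kappaX_ge0|exact: sqr_ge0].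
Qed.

(** Meant for moving $(v,v')$ to a nearby pair while [q] stays frozen; the weight [1 + q ^+ 2] is
    integrable on a bounded interval when [q] is in $L^2$. In the constant, $2/c$ and $1/c^2$ come
    from varying $k^2$ and $1/v$ in the first term, $1$ and $10M$ from varying $v$ and $k^{10}$ in
    the second. *)
Lemma edensity_lipschitz (c M eta : R) v w p r q :
  0 < c -> c <= v -> v <= M -> c <= w ->
  `|v - w| <= eta -> `|p - r| <= eta ->
  edensity v p q <= edensity w r q +
    (2 / c + 1 / c ^+ 2 + 1 + 10 * M) * eta * (1 + q ^+ 2).
Proof.
move=> c0 cv vM cw vw pr.
have v0 : 0 < v := lt_le_trans c0 cv; have w0 : 0 < w := lt_le_trans c0 cw.
have M0 : 0 <= M by rewrite (le_trans _ vM)// ltW.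
have e0 : 0 <= eta by rewrite (le_trans _ vw).
have k2 : kappa p ^+ 2 - kappa r ^+ 2 <= 2 * eta.
  rewrite (le_trans (ler_norm _))// (le_trans (kappaX_lipschitz _ _ _))//.
  by rewrite ler_wpM2l.
have k10 : kappa p ^+ 10 - kappa r ^+ 10 <= 10 * eta.
  rewrite (le_trans (ler_norm _))// (le_trans (kappaX_lipschitz _ _ _))//.
  by rewrite ler_wpM2l.
have wv : w - v <= eta by rewrite (le_trans (ler_norm _))// distrC.
have vw' : v - w <= eta by rewrite (le_trans (ler_norm _)).
have H1 : kappa p ^+ 2 / v - kappa r ^+ 2 / w <= (2 / c + 1 / c ^+ 2) * eta.
  have -> : kappa p ^+ 2 / v - kappa r ^+ 2 / w =
    (kappa p ^+ 2 - kappa r ^+ 2) / v + (w - v) * (kappa r ^+ 2 / (v * w)).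
    by field; rewrite !gt_eqF.
  have vi : v^-1 <= c^-1 by rewrite lef_pV2.
  have wi : w^-1 <= c^-1 by rewrite lef_pV2.
  have v'0 : 0 < v^-1 by rewrite invr_gt0.
  have w'0 : 0 < w^-1 by rewrite invr_gt0.
  rewrite [leRHS]mulrDl lerD//.
    apply: (@le_trans _ _ (2 * eta / v)); first by rewrite ler_pM2r.
    by rewrite [leRHS]mulrAC ler_wpM2l// mulr_ge0.
  apply: (@le_trans _ _ (eta * (kappa r ^+ 2 / (v * w)))).
    by rewrite ler_wpM2r// divr_ge0 ?kappaX_ge0// mulr_ge0// ltW.
  rewrite mulrC ler_wpM2r//; apply: ler_pM; rewrite ?kappaX_ge0 ?kappaX_le1//.
    by rewrite invr_ge0 ltW// mulr_gt0.
  by rewrite (expr2 c) !invfM; apply: ler_pM => //; exact: ltW.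
have H2 : v * kappa p ^+ 10 - w * kappa r ^+ 10 <= (1 + 10 * M) * eta.
  have -> : v * kappa p ^+ 10 - w * kappa r ^+ 10 =
    (v - w) * kappa r ^+ 10 + v * (kappa p ^+ 10 - kappa r ^+ 10) by ring.
  rewrite [leRHS]mulrDl lerD//.
    apply: (@le_trans _ _ (eta * kappa r ^+ 10)); first by rewrite ler_wpM2r// kappaX_ge0.
    by rewrite mulrC ler_wpM2r// kappaX_le1.
  apply: (@le_trans _ _ (v * (10 * eta))); first by rewrite ler_pM2l.
  by rewrite mulrA (mulrC v) ler_wpM2r// ler_wpM2l.
have q0 := sqr_ge0 q.
have := ler_wpM2r q0 H2.
have : (2 / c + 1 / c ^+ 2) * eta <= (2 / c + 1 / c ^+ 2) * eta * (1 + q ^+ 2).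
  rewrite ler_peMr ?lerDl//; apply: mulr_ge0 => //.
  by rewrite addr_ge0// divr_ge0// ?exprn_ge0// ltW.
have : 0 <= (1 + 10 * M) * eta by rewrite mulr_ge0// addr_ge0// mulr_ge0.
rewrite /edensity.
set A := kappa p ^+ 2 / v in H1 *; set B := kappa r ^+ 2 / w in H1 *.
set C := 2 / c + 1 / c ^+ 2 in H1 *.
nra.
Qed.

Lemma edensity_parallelogram v p q r :
  edensity v p ((q + r) / 2) + v * kappa p ^+ 10 * ((q - r) ^+ 2 / 4) =
  (edensity v p q + edensity v p r) / 2.
Proof. by rewrite /edensity; set a := _ / v; set b := v * _; field. Qed.

End kappa.

(** * Integration of real functions *)

Section integration.
Context {R : realType}.
Local Notation mu := (@lebesgue_measure R).
Implicit Types (A : set R) (f g q : R -> R) (x y : R).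

Lemma le_integrableR A f g : measurable A -> measurable_fun A f ->
  (forall t, A t -> `|f t| <= g t) -> mu.-integrable A (EFin \o g) ->
  mu.-integrable A (EFin \o f).
Proof.
move=> mA mf fg; apply: le_integrable => //; first exact/measurable_EFinP.
by move=> t At /=; rewrite lee_fin (le_trans (fg t At))// ler_norm.
Qed.

Lemma integrable_cst_itv x y (c : R) : mu.-integrable `]x, y[ (EFin \o cst c).
Proof.
apply: measurable_bounded_integrable => //.
  by rewrite /= lebesgue_measure_itv/=; case: ifP => _; rewrite -?EFinD ltry.
exact: bounded_cst.
Qed.

Lemma integrable_measurable A f :
  mu.-integrable A (EFin \o f) -> measurable_fun A f.
Proof. by move=> fi; apply/measurable_EFinP; exact: (measurable_int mu). Qed.

Lemma integrable_normR A f : measurable A -> mu.-integrable A (EFin \o f) ->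
  mu.-integrable A (EFin \o (fun t => `|f t|)).
Proof.
move=> mA fi; have mf := integrable_measurable fi.
apply: le_integrable fi => //.
  by apply/measurable_EFinP/measurableT_comp.
by move=> t At; rewrite /= normr_id.
Qed.

Lemma integrableZR A f (c : R) : measurable A -> mu.-integrable A (EFin \o f) ->
  mu.-integrable A (EFin \o (fun t => c * f t)).
Proof.
move=> mA fi; have h := @integrableZl _ _ _ mu A mA c _ fi.
by apply: eq_integrable h => // t _ /=; rewrite EFinM.
Qed.

Lemma integrableM_bounded A (c : R) f g : measurable A -> measurable_fun A g ->
  (forall t, A t -> `|g t| <= c) -> mu.-integrable A (EFin \o f) ->
  mu.-integrable A (EFin \o (fun t => g t * f t)).
Proof.
move=> mA mg gc fi; have mf := integrable_measurable fi.
apply: (@le_integrableR _ _ (fun t => `|c| * `|f t|)) => //.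
- exact: measurable_funM.
- by move=> t At; rewrite normrM ler_wpM2r// (le_trans (gc t At))// ler_norm.
- by apply: integrableZR => //; exact: integrable_normR.
Qed.

Lemma integrable_bounded x y (c : R) f : measurable_fun `]x, y[ f ->
  (forall t, x < t < y -> `|f t| <= c) -> mu.-integrable `]x, y[ (EFin \o f).
Proof.
move=> mf fc; apply: (@le_integrableR _ _ (cst c)) => //.
exact: integrable_cst_itv.
Qed.

Lemma integrableDR A f g : measurable A -> mu.-integrable A (EFin \o f) ->
  mu.-integrable A (EFin \o g) -> mu.-integrable A (EFin \o (fun t => f t + g t)).
Proof.
move=> mA fi gi; have h := @integrableD _ _ _ mu A mA _ _ fi gi.
by apply: eq_integrable h => // t _ /=; rewrite EFinD.
Qed.

Lemma integrableBR A f g : measurable A -> mu.-integrable A (EFin \o f) ->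
  mu.-integrable A (EFin \o g) -> mu.-integrable A (EFin \o (fun t => f t - g t)).
Proof.
move=> mA fi gi; have h := @integrableB _ _ _ mu A mA _ _ fi gi.
by apply: eq_integrable h => // t _ /=; rewrite EFinB.
Qed.

Lemma integrable_sub_itv f (a b x y : R) : a <= x -> y <= b ->
  mu.-integrable `]a, b[ (EFin \o f) -> mu.-integrable `]x, y[ (EFin \o f).
Proof.
move=> ax yb; apply: integrableS => //.
by apply: subset_itv; rewrite bnd_simp.
Qed.

Lemma Rintegral_itv_split f x y m : x <= m -> m <= y ->
  mu.-integrable `]x, y[ (EFin \o f) ->
  \int[mu]_(t in `]x, y[) f t =
  \int[mu]_(t in `]x, m[) f t + \int[mu]_(t in `]m, y[) f t.
Proof.
move=> xm; rewrite le_eqVlt => /predU1P[->|my] fi.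
  by rewrite [X in _ + Rintegral _ X _]set_itv_ge ?bnd_simp// Rintegral_set0 addr0.
rewrite [X in _ = X + _]Rintegral_itv_bndo_bndc; last first.
  exact: (integrable_sub_itv (lexx x) (ltW my) fi).
have h := @Rintegral_itvB _ f (BRight x) (BLeft y) m fi; by rewrite -h ?bnd_simp// addrC subrK.
Qed.

Lemma Rintegral_itv_ge f x y : y <= x -> \int[mu]_(t in `]x, y[) f t = 0.
Proof. by move=> yx; rewrite set_itv_ge ?bnd_simp -?leNgt// Rintegral_set0. Qed.

Lemma Rintegral_itv_cst (c : R) x y : x <= y ->
  \int[mu]_(t in `]x, y[) (cst c t) = c * (y - x).
Proof.
move=> xy; rewrite Rintegral_cst//= lebesgue_measure_itv/= lte_fin.
case: ltP => // yx; have -> : y = x by apply/eqP; rewrite eq_le yx xy.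
by rewrite subrr.
Qed.

Lemma Rintegral_near_cst (f : R -> R) (a b c e : R) : a <= b ->
  mu.-integrable `]a, b[ (EFin \o f) ->
  (forall t, a < t < b -> `|f t - c| <= e) ->
  `|\int[mu]_(t in `]a, b[) f t - c * (b - a)| <= e * (b - a).
Proof.
move=> ab fi fc.
rewrite -(Rintegral_itv_cst c ab) -RintegralB//; last exact: integrable_cst_itv.
have di : mu.-integrable `]a, b[ (EFin \o (fun t => f t - cst c t)).
  by apply: integrableBR => //; exact: integrable_cst_itv.
apply: le_trans (le_normr_Rintegral _ di) _ => //.
rewrite -(Rintegral_itv_cst _ ab).
apply: le_Rintegral; rewrite ?integrable_cst_itv//; first exact: integrable_normR.
Qed.

(** Cauchy-Schwarz against the constant 1: with [l] the mean of $|q|$, integrating $(|q|-l)^2\ge0$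
    gives $2lI-l^2(y-x)\le\int q^2$, whose left side is $I^2/(y-x)$. *)
Lemma sqr_Rintegral_le q x y : x <= y -> mu.-integrable `]x, y[ (EFin \o q) ->
  mu.-integrable `]x, y[ (EFin \o (fun t => q t ^+ 2)) ->
  (\int[mu]_(t in `]x, y[) `|q t|) ^+ 2 <= (y - x) * \int[mu]_(t in `]x, y[) (q t ^+ 2).
Proof.
rewrite le_eqVlt => /predU1P[<-|xy] qi q2i.
  by rewrite subrr mul0r Rintegral_itv_ge// expr0n.
have qni := integrable_normR (measurable_itv _) qi.
set I := \int[mu]_(t in `]x, y[) `|q t|.
set l := I / (y - x).
have yx : 0 < y - x by rewrite subr_gt0.
have : \int[mu]_(t in `]x, y[) (2 * l * `|q t| - cst (l ^+ 2) t) <=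
    \int[mu]_(t in `]x, y[) (q t ^+ 2).
  apply: le_Rintegral => //.
    by apply: integrableBR => //; [exact: integrableZR|exact: integrable_cst_itv].
  move=> t _ /=; rewrite -subr_ge0 -(real_normK (num_real (q t))).
  have -> : `|q t| ^+ 2 - (2 * l * `|q t| - l ^+ 2) = (`|q t| - l) ^+ 2 by ring.
  exact: sqr_ge0.
rewrite RintegralB//; last 2 first.
- exact: integrableZR.
- exact: integrable_cst_itv.
rewrite RintegralZl// Rintegral_itv_cst ?(ltW xy)// -/I => h.
have -> : I ^+ 2 = (y - x) * (2 * l * I - l ^+ 2 * (y - x)).
  by rewrite /l; field; rewrite gt_eqF.
by rewrite ler_pM2l.
Qed.

Lemma ae_imply (P Q : R -> Prop) : (forall t, P t -> Q t) ->
  {ae mu, forall t, P t} -> {ae mu, forall t, Q t}.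
Proof. by move=> PQ; apply: (@filterS _ _ (ae_filter_ringOfSetsType mu)). Qed.

Lemma Rdominated_convergence A (F : nat -> R -> R) f g : measurable A ->
  (forall n, measurable_fun A (F n)) -> measurable_fun A f ->
  {ae mu, forall t, A t -> F n t @[n --> \oo] --> f t} ->
  {ae mu, forall t, A t -> forall n, `|F n t| <= g t} -> mu.-integrable A (EFin \o g) ->
  mu.-integrable A (EFin \o f) /\
  \int[mu]_(t in A) F n t @[n --> \oo] --> \int[mu]_(t in A) f t.
Proof.
move=> mA mF mf Ff Fg gi.
have [||||| fi _ h] :=
  @dominated_convergence _ _ _ mu A mA (fun n => EFin \o F n) (EFin \o f) (EFin \o g).
- move=> n; apply/(@measurable_EFinP _ _ _ A (F n)); exact: mF.
- apply/measurable_EFinP; exact: mf.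
- apply: ae_imply Ff => t + At => /(_ At) h. apply: cvg_EFin; [exact: nearW|exact: h].
- exact: gi.
- by apply: ae_imply Fg => t Fg n At /=; rewrite lee_fin Fg.
split => //; apply: fine_cvg.
by rewrite /Rintegral fineK//; exact: integrable_fin_num.
Qed.

(** The bound [c] is only required eventually and up to every [e], the form in which a minimizing
    sequence supplies it. Integrability of [f] is part of the conclusion: this is how the limit of
    the second derivatives is seen to lie in $L^2$. *)
Lemma Rfatou A (F : nat -> R -> R) f (c : R) : measurable A ->
  (forall n, measurable_fun A (F n)) -> measurable_fun A f ->
  {ae mu, forall t, A t -> F n t @[n --> \oo] --> f t} ->
  (forall n t, A t -> 0 <= F n t) -> (forall t, A t -> 0 <= f t) ->
  (forall n, mu.-integrable A (EFin \o F n)) ->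
  (forall e : R, 0 < e -> \forall n \near \oo, \int[mu]_(t in A) F n t <= c + e) ->
  mu.-integrable A (EFin \o f) /\ \int[mu]_(t in A) f t <= c.
Proof.
move=> mA mF mf Ff F0 f0 Fi Fc.
have key : (\int[mu]_(t in A) (f t)%:E <= c%:E)%E.
  have -> : (\int[mu]_(t in A) (f t)%:E = \int[mu]_(t in A) limn_einf (fun n => (F n t)%:E))%E.
    apply: ae_eq_integral => //.
    - by apply/measurable_EFinP; exact: mf.
    - apply: measurableT_comp => //; apply: measurable_fun_limn_esup => n.
      by apply: measurableT_comp => //; apply/measurable_EFinP; exact: mF.
    - apply: ae_imply Ff => t + At => /(_ At) h; apply/esym.
      have h' : (F n t)%:E @[n --> \oo] --> (f t)%:E 
        by apply: cvg_EFin; [exact: nearW|exact: h].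
      by have [-> _] := cvg_limn_einf_sup h'.
  apply: le_trans (@fatou _ _ _ mu A mA (fun n t => (F n t)%:E) _ _) _.
  - by move=> n; apply/measurable_EFinP; exact: mF.
  - by move=> n t At; rewrite lee_fin F0.
  apply/lee_addgt0Pr => e e0; rewrite -EFinD.
  rewrite limn_einf_lim; apply: lime_le; first exact: is_cvg_einfs.
  have [N _ hN] := Fc e e0.
  near=> n; have nN : (N <= n)%N by near: n; exact: nbhs_infty_ge.
  apply: (@le_trans _ _ (\int[mu]_(t in A) (F n t)%:E)%E).
    by apply: ereal_inf_lbound; exists n => //=.
  have := hN n nN; rewrite -lee_fin; apply: le_trans.
  by rewrite /Rintegral fineK//; apply: (@integrable_fin_num _ _ _ mu A mA _ (Fi n)).
have fi : mu.-integrable A (EFin \o f).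
  apply/integrableP; split; first by apply/measurable_EFinP; exact: mf.
  apply: le_lt_trans (ltry c); apply: le_trans key.
  rewrite le_eqVlt; apply/orP; left; apply/eqP/eq_integral => t.
  by rewrite inE => At /=; rewrite ger0_norm// f0.
split => //; rewrite -lee_fin /Rintegral fineK//.
exact: (@integrable_fin_num _ _ _ mu A mA _ fi).
Unshelve. all: by end_near. Qed.

End integration.

(** * Continuity on segments and smooth ramps *)

Section continuity.
Context {R : realType}.
Implicit Types (f : R -> R) (a b x : R).

Lemma within_itv_continuousP a b f : {within `[a, b], continuous f} <->
  (forall x, a <= x <= b -> forall e, 0 < e -> exists2 d, 0 < d &
    forall y, a <= y <= b -> `|x - y| < d -> `|f x - f y| <= e).
Proof.
split.
  move=> /subspace_continuousP fc x xab e e0.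
  have /fc /cvgrPdist_le /(_ e e0) : `[a, b]%classic x by rewrite /= in_itv.
  rewrite /within/= => -[d/= d0 dP]; exists d => // y yab xy.
  by apply: dP => //=; rewrite in_itv.
move=> h; apply/subspace_continuousP => x; rewrite /= in_itv/= => xab.
apply/cvgrPdist_le => e e0; have [d d0 dP] := h x xab e e0.
by exists d => //= y xy; rewrite /= in_itv/= => yab; exact: dP.
Qed.

Lemma within_itv_measurable a b f : {within `[a, b], continuous f} ->
  measurable_fun (`]a, b[ : set R) f.
Proof.
move=> fc; apply: (@measurable_funS _ _ _ _ `[a, b]) => //.
  by apply: subset_itv; rewrite bnd_simp.
exact: subspace_continuous_measurable_fun.
Qed.

Lemma within_itv_bounded a b f : {within `[a, b], continuous f} ->
  exists2 M, 0 < M & forall x, a <= x <= b -> `|f x| <= M.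
Proof.
move=> fc; have := continuous_compact fc (@segment_compact _ a b).
move=> /compact_bounded[M [Mr MP]].
exists (`|M| + 1); first by rewrite ltr_wpDl.
move=> x xab; apply: MP; last by exists x; rewrite //= in_itv.
by rewrite (le_lt_trans (ler_norm _))// ltrDl.
Qed.

(** Lets a quadratic spline be differentiated through one algebraic inequality, with no separate
    treatment of one-sided limits at its knots. *)
Lemma quadratic_remainder_derive f (df : R -> R) (C : R) :
  (forall t h, `|f (t + h) - f t - h * df t| <= C * h ^+ 2) ->
  forall t : R, is_derive t (1 : R) f (df t).
Proof.
move=> H t.
have cv : h^-1 *: (f (h *: 1 + t) - f t) @[h --> 0^'] --> df t.
  apply/cvgrPdist_le => e e0.
  have C0 : 0 <= C.
    by have := le_trans (normr_ge0 _) (H 0 1); rewrite expr1n mulr1.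
  near=> h.
  have h0 : h != 0 by near: h; exact: nbhs_dnbhs_neq.
  rewrite -normrN opprB /GRing.scale/= mulr1 (addrC h).
  have -> : h^-1 * (f (t + h) - f t) - df t = h^-1 * (f (t + h) - f t - h * df t).
    by field.
  rewrite normrM normfV mulrC ler_pdivrMr ?normr_gt0//.
  apply: (le_trans (H t h)); rewrite -(real_normK (num_real h)) expr2 mulrA ler_wpM2r//.
  have : `|h| <= e / (C + 1).
    near: h; apply: dnbhs0_le; rewrite divr_gt0// ltr_wpDl//.
  have C1 : 0 < C + 1 by rewrite ltr_wpDl.
  rewrite ler_pdivlMr// => hC; apply: le_trans hC.
  by rewrite mulrC ler_wpM2l// lerDl.
have d : derivable f t 1 by apply/cvg_ex; exists (df t).
by apply: DeriveDef => //; exact/cvg_lim.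
Unshelve. all: by end_near. Qed.

End continuity.

Section spline.
Context {R : realType}.
Implicit Types t h x e : R.

Let relu t := Num.max 0 t.

Let relu_quad t h : `|relu (t + h) ^+ 2 - relu t ^+ 2 - h * (2 * relu t)| <= h ^+ 2.
Proof.
rewrite /relu; case: (ltP 0 (t + h)) => th; case: (ltP 0 t) => t0;
  rewrite ler_norml; apply/andP; split; nra.
Qed.

Let relu_lip t h : `|relu (t + h) - relu t| <= `|h|.
Proof.
rewrite /relu; case: (ltP 0 (t + h)) => th; case: (ltP 0 t) => t0;
  rewrite ler_norml; apply/andP; split; have := ler_norm h; have := ler_norm (- h);
  rewrite normrN; lra.
Qed.

(* A quadratic spline, which is C^1 because relu t ^+ 2 has derivative 2 * relu t. *)
Definition smoothstep t := 2 * (relu t ^+ 2 - 2 * relu (t - 1 / 2) ^+ 2 + relu (t - 1) ^+ 2).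
Definition dsmoothstep t := 4 * (relu t - 2 * relu (t - 1 / 2) + relu (t - 1)).

Lemma smoothstep_le0 t : t <= 0 -> smoothstep t = 0.
Proof.
by move=> t0; rewrite /smoothstep /relu !max_l ?expr0n/=; [ring|lra..].
Qed.

Lemma smoothstep_ge1 t : 1 <= t -> smoothstep t = 1.
Proof.
by move=> t1; rewrite /smoothstep /relu !max_r; [field|lra..].
Qed.

Lemma dsmoothstep_le0 t : t <= 0 -> dsmoothstep t = 0.
Proof.
by move=> t0; rewrite /dsmoothstep /relu !max_l; [ring|lra..].
Qed.

Lemma dsmoothstep_ge1 t : 1 <= t -> dsmoothstep t = 0.
Proof.
by move=> t1; rewrite /dsmoothstep /relu !max_r; [field|lra..].
Qed.

Lemma dsmoothstep_ge0 t : 0 <= dsmoothstep t.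
Proof.
rewrite /dsmoothstep /relu; case: (ltP 0 t) => t0; case: (ltP 0 (t - 1 / 2)) => t1;
case: (ltP 0 (t - 1)) => t2; lra.
Qed.

Lemma smoothstep_bound t : `|smoothstep t| <= 1.
Proof.
rewrite ler_norml /smoothstep /relu; case: (ltP 0 t) => t0; case: (ltP 0 (t - 1 / 2)) => t1;
case: (ltP 0 (t - 1)) => t2; apply/andP; split; nra.
Qed.

Lemma smoothstep_quad t h :
  `|smoothstep (t + h) - smoothstep t - h * dsmoothstep t| <= 8 * h ^+ 2.
Proof.
rewrite /smoothstep /dsmoothstep.
have := relu_quad t h; have := relu_quad (t - 1 / 2) h; have := relu_quad (t - 1) h.
rewrite !(addrAC _ (- _) h) !ler_norml.
set a := relu (t + h); set b := relu t; set c := relu (t + h - 1 / 2).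
set d := relu (t - 1 / 2); set i := relu (t + h - 1); set j := relu (t - 1).
move=> /andP[? ?] /andP[? ?] /andP[? ?]; apply/andP; split; nra.
Qed.

Lemma dsmoothstep_lip t h : `|dsmoothstep (t + h) - dsmoothstep t| <= 16 * `|h|.
Proof.
rewrite /dsmoothstep.
have := relu_lip t h; have := relu_lip (t - 1 / 2) h; have := relu_lip (t - 1) h.
rewrite !(addrAC _ (- _) h) !ler_norml.
move=> /andP[? ?] /andP[? ?] /andP[? ?]; apply/andP; split; lra.
Qed.

(** For small [e] this is a $C^1$ substitute for the indicator of $]x,\infty[$, and [dramp x e] is a
    one-sided mollifier on $[x,x+e]$. *)
Definition ramp x e t := smoothstep ((t - x) / e).
Definition dramp x e t := e^-1 * dsmoothstep ((t - x) / e).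

Lemma ramp_le x e t : 0 < e -> t <= x -> ramp x e t = 0.
Proof.
by move=> e0 tx; rewrite /ramp smoothstep_le0// ler_pdivrMr// mul0r subr_le0.
Qed.

Lemma ramp_ge x e t : 0 < e -> x + e <= t -> ramp x e t = 1.
Proof.
by move=> e0 tx; rewrite /ramp smoothstep_ge1// ler_pdivlMr// mul1r; lra.
Qed.

Lemma ramp_bound x e t : `|ramp x e t| <= 1.
Proof. exact: smoothstep_bound. Qed.

Lemma dramp_le x e t : 0 < e -> t <= x -> dramp x e t = 0.
Proof.
by move=> e0 tx; rewrite /dramp dsmoothstep_le0 ?mulr0// ler_pdivrMr// mul0r subr_le0.
Qed.

Lemma dramp_ge x e t : 0 < e -> x + e <= t -> dramp x e t = 0.
Proof.
by move=> e0 tx; rewrite /dramp dsmoothstep_ge1 ?mulr0// ler_pdivlMr// mul1r; lra.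
Qed.

Lemma dramp_ge0 x e t : 0 < e -> 0 <= dramp x e t.
Proof. by move=> e0; rewrite mulr_ge0 ?dsmoothstep_ge0// invr_ge0 ltW. Qed.

Lemma ramp_quad x e t h : 0 < e ->
  `|ramp x e (t + h) - ramp x e t - h * dramp x e t| <= 8 / e ^+ 2 * h ^+ 2.
Proof.
move=> e0; rewrite /ramp /dramp.
have := smoothstep_quad ((t - x) / e) (h / e).
have -> : (t + h - x) / e = (t - x) / e + h / e by rewrite -mulrDl addrAC.
rewrite (mulrA h e^-1) (_ : 8 / e ^+ 2 * h ^+ 2 = 8 * (h / e) ^+ 2)//; field; by rewrite gt_eqF.
Qed.

Lemma is_derive_ramp x e t : 0 < e -> is_derive t 1 (ramp x e) (dramp x e t).
Proof.
by move=> e0; apply: (@quadratic_remainder_derive _ _ _ (8 / e ^+ 2)) => *; exact: ramp_quad.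
Qed.

Lemma continuous_dramp x e : 0 < e -> continuous (dramp x e).
Proof.
move=> e0 t; apply/cvgrPdist_le => d d0; near=> s.
have := dsmoothstep_lip ((s - x) / e) ((t - s) / e).
have -> : (s - x) / e + (t - s) / e = (t - x) / e by field; rewrite gt_eqF.
move=> h; rewrite /dramp -mulrBr normrM.
apply: (@le_trans _ _ (`|e^-1| * (16 * `|(t - s) / e|))); first by rewrite ler_wpM2l.
have -> : `|e^-1| * (16 * `|(t - s) / e|) = 16 / e ^+ 2 * `|t - s|.
  by rewrite normrM !normfV (gtr0_norm e0); field; rewrite gt_eqF.
have c0 : 0 < 16 / e ^+ 2 by rewrite divr_gt0// exprn_gt0.
rewrite mulrC -ler_pdivlMr//; near: s.
apply: cvgr_dist_le => //.
by rewrite divr_gt0// divr_gt0// exprn_gt0.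
Unshelve. all: by end_near. Qed.

Lemma Rintegral_dramp (a b x e : R) : 0 < e -> a <= x -> x + e <= b ->
  \int[@lebesgue_measure R]_(t in `]a, b[) dramp x e t = 1.
Proof.
move=> e0 ax xb.
have ab : a < b by lra.
have dc : {within `[a, b], continuous (dramp x e)}.
  by apply: continuous_subspaceT; exact: continuous_dramp.
have rc : continuous (ramp x e).
  move=> t; apply/differentiable_continuous/derivable1_diffP.
  by have [] := is_derive_ramp x t e0.
have h : (\int[@lebesgue_measure R]_(t in `[a, b]) (dramp x e t)%:E =
    (ramp x e b)%:E - (ramp x e a)%:E)%E.
  apply: continuous_FTC2 => //.
    split.
    - by move=> t _; have [] := is_derive_ramp x t e0.
    - exact/cvg_at_right_filter/rc.
    - exact/cvg_at_left_filter/rc.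
  by move=> t _; rewrite derive1E; have [_ ->] := is_derive_ramp x t e0.
have di : (@lebesgue_measure R).-integrable `[a, b] (EFin \o dramp x e).
  by apply: continuous_compact_integrable => //; exact: segment_compact.
rewrite Rintegral_itv_obnd_cbnd; last first.
  by apply: integrableS di => //; apply: subset_itv; rewrite bnd_simp.
rewrite Rintegral_itv_bndo_bndc; last first.
  by apply: integrableS di => //; apply: subset_itv; rewrite bnd_simp.
by rewrite /Rintegral h ramp_ge// ramp_le// sube0.
Qed.

End spline.

(** * The du Bois-Reymond lemma *)

Section du_bois_reymond.
Context {R : realType}.
Local Notation mu := (@lebesgue_measure R).
Local Notation D := (`]-1, 1[%classic : set R).
Implicit Types (f g q : R -> R) (x y t e : R).

Lemma dramp_bounded x e : 0 < e ->
  exists2 M, 0 < M & forall t, -1 <= t <= 1 -> `|dramp x e t| <= M.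
Proof.
by move=> e0; apply: within_itv_bounded; apply: continuous_subspaceT; exact: continuous_dramp.
Qed.

Lemma measurable_dramp x e (A : set R) : 0 < e -> measurable A -> measurable_fun A (dramp x e).
Proof.
move=> e0 mA; apply: measurable_funTS; exact: continuous_measurable_fun (continuous_dramp e0).
Qed.

Lemma integrable_mul_dramp f x e : 0 < e -> mu.-integrable D (EFin \o f) ->
  mu.-integrable D (EFin \o (fun t => dramp x e t * f t)).
Proof.
move=> e0 fi; have [M _ MP] := dramp_bounded x e0.
apply: (@integrableM_bounded _ _ M) => //; first exact: measurable_dramp.
by move=> t; rewrite /= in_itv/= => /andP[? ?]; apply: MP; rewrite !ltW.
Qed.

(** [dramp x e] is nonnegative, has integral 1 and vanishes off $[x,x+e]$, so the integral is a
    weighted mean of values of [f] on that segment. *)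
Lemma ramp_average f x e (eta : R) : 0 < e -> -1 <= x -> x + e <= 1 ->
  mu.-integrable D (EFin \o f) ->
  (forall t, x <= t <= x + e -> `|f t - f x| <= eta) ->
  `|\int[mu]_(t in D) (dramp x e t * f t) - f x| <= eta.
Proof.
move=> e0 x1 xe fi fx.
have di : mu.-integrable D (EFin \o dramp x e).
  have := integrable_mul_dramp x e0 (integrable_cst_itv (-1) 1 1).
  by apply: eq_integrable => // t _; rewrite /= mulr1.
have dcE (c : R) : \int[mu]_(t in D) (c * dramp x e t) = c.
  by rewrite RintegralZl// Rintegral_dramp// mulr1.
have dfi := integrable_mul_dramp x e0 fi.
rewrite -{1}(dcE (f x)) -RintegralB//; last exact: integrableZR.
apply: le_trans (le_normr_Rintegral _ _) _ => //.
  by apply: integrableBR => //; exact: integrableZR.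
rewrite -[leRHS](dcE eta); apply: le_Rintegral => //.
- by apply: integrable_normR => //; apply: integrableBR => //; exact: integrableZR.
- exact: integrableZR.
move=> t _; rewrite mulrC -mulrBl normrM (ger0_norm (dramp_ge0 _ _ e0)).
have [tx|tx] := leP t x; first by rewrite dramp_le// !mulr0.
have [te|te] := leP (x + e) t; first by rewrite dramp_ge// !mulr0.
by rewrite ler_wpM2r ?dramp_ge0// fx// !ltW.
Qed.

Lemma test_function_ramp x y e : 0 < e -> -1 < x -> x <= y -> y + e < 1 ->
  test_function (fun t => ramp x e t - ramp y e t) /\
  derive1 (fun t => ramp x e t - ramp y e t) = (fun t => dramp x e t - dramp y e t).
Proof.
move=> e0 x1 xy ye.
have dE t : is_derive t (1 : R) (fun t => ramp x e t - ramp y e t) (dramp x e t - dramp y e t).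
  have h1 := is_derive_ramp x t e0; have h2 := is_derive_ramp y t e0.
  exact: is_deriveB.
have dE' : derive1 (fun t => ramp x e t - ramp y e t) = (fun t => dramp x e t - dramp y e t).
  by apply/funext => t; rewrite derive1E; have [_ ->] := dE t.
split => //; split.
- by move=> t; have [] := dE t.
- by rewrite dE' => t; apply: cvgB; exact: continuous_dramp.
- have sub : [set t | ramp x e t - ramp y e t != 0] `<=` `[x, y + e].
    move=> t /=; rewrite in_itv/=; apply: contraR; rewrite negb_and -!ltNge.
    case/orP => h; first by rewrite !ramp_le ?subrr//; lra.
    by rewrite !ramp_ge ?subrr//; lra.
  apply: subset_trans (closureS sub) _; rewrite -(closure_id _).1; last exact: itv_closed.
  by apply: subset_itv; rewrite bnd_simp.
Qed.

(** The test function [ramp x e - ramp y e] tends to the indicator of $]x,y]$ as $e\to0$, so its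
    pairing with [g] tends to the integral. Its derivative pairs with [f] as a difference of two
    averages, which tend to [f x] and [f y]. *)
Lemma weak_derivative_Rintegral_interior f g x y :
  {within `[-1, 1], continuous f} -> mu.-integrable D (EFin \o g) ->
  weak_derivative f g -> -1 < x -> x <= y -> y < 1 ->
  f y - f x = \int[mu]_(t in `]x, y[) g t.
Proof.
move=> fc gi fg x1 xy y1.
have fi : mu.-integrable D (EFin \o f).
  have [M _ MP] := within_itv_bounded fc.
  apply: (@integrable_bounded _ _ _ M); first exact: within_itv_measurable.
  by move=> t /andP[? ?]; apply: MP; rewrite !ltW.
(* The factor $(1-y)/2$ keeps $y+e_n<1$ for every [n], so that the support of the test function
   stays inside the open interval. *)
pose e n : R := (1 - y) / 2 * harmonic n.
have e0 n : 0 < e n.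
  by apply: mulr_gt0; [rewrite divr_gt0// subr_gt0|rewrite /harmonic/= invr_gt0 ltr0n].
have ye n : y + e n < 1.
  have : e n <= (1 - y) / 2.
    rewrite ler_piMr ?divr_ge0 ?subr_ge0 ?(ltW y1)// /harmonic/= invf_le1 ?ltr0n//.
    by rewrite ler1n.
  by lra.
have e_lt (d : R) : 0 < d -> \forall n \near \oo, e n < d.
  move=> d0; have y0 : 0 < (1 - y) / 2 by rewrite divr_gt0// subr_gt0.
  have := @cvgr_lt _ _ _ _ _ _ (@cvg_harmonic R) (d / ((1 - y) / 2)).
  rewrite divr_gt0// => /(_ _ isT); apply: filterS => n.
  rewrite /e ltr_pdivlMr// (mulrC (harmonic n)).
  exact.
pose F n t := (ramp x (e n) t - ramp y (e n) t) * g t.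
(* Each ramp vanishes at its own starting point, hence the half-open limit: [t = x] is excluded and
   [t = y] included. *)
pose h t := (if x < t <= y then 1 else 0) * g t.
have mD : measurable D by [].
have mg := integrable_measurable gi.
have cramp n z : continuous (ramp z (e n)).
  move=> t; apply/differentiable_continuous/derivable1_diffP.
  by have [] := is_derive_ramp z t (e0 n).
have Fcvg t : F n t @[n --> \oo] --> h t.
  apply: cvgM; last exact: cvg_cst.
  case: ifPn => [/andP[xt ty]|].
    apply: cvg_near_cst.
    have := e_lt (t - x); rewrite subr_gt0 => /(_ xt); apply: filterS => n en.
    by rewrite ramp_ge// ?ramp_le ?subr0//; lra.
  rewrite negb_and -!leNgt -ltNge => /orP[tx|yt].
    by apply: cvg_near_cst; near=> n; rewrite !ramp_le ?subrr//; lra.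
  apply: cvg_near_cst.
  have := e_lt (t - y); rewrite subr_gt0 => /(_ yt); apply: filterS => n en.
  by rewrite !ramp_ge ?subrr//; lra.
have mF n : measurable_fun D (F n).
  apply: measurable_funM => //; apply: measurable_funB.
    by apply: measurable_funTS; exact: continuous_measurable_fun (cramp n x).
  by apply: measurable_funTS; exact: continuous_measurable_fun (cramp n y).
have mh : measurable_fun D h by apply: (measurable_fun_cvg mF) => t _; exact: Fcvg.
have [hi Fh] : mu.-integrable D (EFin \o h) /\
    \int[mu]_(t in D) F n t @[n --> \oo] --> \int[mu]_(t in D) h t.
  apply: (@Rdominated_convergence _ D F h (fun t => 2 * `|g t|)) => //.
  - by apply: aeW => t _; exact: Fcvg.
  - apply: aeW => t _ n; rewrite normrM ler_wpM2r// (le_trans (ler_normB _ _))//.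
    by have := ramp_bound x (e n) t; have := ramp_bound y (e n) t; lra.
  - by apply: integrableZR => //; exact: integrable_normR.
have hE : \int[mu]_(t in D) h t = \int[mu]_(t in `]x, y[) g t.
  have y1' := ltW y1; have x1' := ltW x1.
  rewrite (Rintegral_itv_split (le_trans x1' xy) y1' hi).
  have hi' := integrable_sub_itv (lexx _) y1' hi.
  rewrite (Rintegral_itv_split x1' xy hi').
  rewrite (@eq_Rintegral _ _ _ mu _ (fun=> 0) h); last first.
    move=> t; rewrite inE/= in_itv/= => /andP[_ tx].
    by rewrite /h ltNge (ltW tx)/= mul0r.
  rewrite [X in _ + X](@eq_Rintegral _ _ _ mu _ (fun=> 0) h); last first.
    move=> t; rewrite inE/= in_itv/= => /andP[yt _].
    by rewrite /h andbC leNgt yt/= mul0r.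
  rewrite !(Rintegral_cst, mul0r)// ?addr0 ?add0r.
  apply: eq_Rintegral => t; rewrite inE/= in_itv/= => /andP[xt ty].
  by rewrite /h xt ltW// mul1r.
have Fw n : - (\int[mu]_(t in D) F n t) =
    \int[mu]_(t in D) (dramp x (e n) t * f t) - \int[mu]_(t in D) (dramp y (e n) t * f t).
  have [tf dE] := test_function_ramp (e0 n) x1 xy (ye n).
  have := fg _ tf; rewrite dE => wE.
  rewrite -RintegralB//; [|exact: integrable_mul_dramp..].
  rewrite (@eq_Rintegral _ _ _ mu _ (fun t => g t * (ramp x (e n) t - ramp y (e n) t))).
    by rewrite -wE; apply: eq_Rintegral => t _; ring.
  by move=> t _; rewrite /F mulrC.
have lim2 : - (\int[mu]_(t in D) F n t) @[n --> \oo] --> f x - f y.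
  have avg z : -1 < z -> z <= y ->
      \int[mu]_(t in D) (dramp z (e n) t * f t) @[n --> \oo] --> f z.
    move=> z1 zy; apply/cvgrPdist_le => d d0.
    have zI : -1 <= z <= 1 by lra.
    have [r r0 rP] := (within_itv_continuousP _ _ _).1 fc z zI d d0.
    have := e_lt r r0; apply: filterS => n en.
    have yen := ye n; have en0 := e0 n.
    rewrite distrC; apply: ramp_average => //; [exact: ltW|lra|].
    move=> t /andP[zt te]; rewrite distrC; apply: rP; first lra.
    by rewrite ler0_norm; lra.
  under eq_cvg do rewrite Fw.
  by apply: cvgB; apply: avg => //; exact: lt_le_trans xy.
have := cvg_unique _ lim2 (cvgN Fh); rewrite hE => /(_ (@norm_hausdorff _ _)) h'.
by rewrite -opprB h' opprK.
Unshelve. all: by end_near. Qed.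

End du_bois_reymond.

(** * Chain rule for functions with a square integrable derivative *)

Section chain_rule.
Context {R : realType}.
Local Notation mu := (@lebesgue_measure R).
Local Notation D := (`]-1, 1[%classic : set R).
Implicit Types (f g p q : R -> R) (x y s t : R).

Lemma L2_sqr_integrable q : L2 q -> mu.-integrable D (EFin \o (fun t => q t ^+ 2)).
Proof. by case. Qed.

Lemma L2_integrable q : L2 q -> mu.-integrable D (EFin \o q).
Proof.
move=> [mq q2]; apply: (@le_integrableR _ D q (fun t => cst 1 t + q t ^+ 2)) => //.
  move=> t _ /=; rewrite -(real_normK (num_real (q t))).
  by have := sqr_ge0 (`|q t| - 1); nra.
by apply: integrableDR => //; exact: integrable_cst_itv.
Qed.

Lemma L2_subitv_integrable q x y : L2 q -> -1 <= x -> y <= 1 ->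
  mu.-integrable `]x, y[ (EFin \o q) /\
  mu.-integrable `]x, y[ (EFin \o (fun t => q t ^+ 2)).
Proof.
move=> qL x1 y1; split; apply: integrable_sub_itv x1 y1 _.
  exact: L2_integrable.
exact: L2_sqr_integrable.
Qed.

Lemma L2_sqr_Rintegral_le q x y : L2 q -> -1 <= x -> x <= y -> y <= 1 ->
  (\int[mu]_(t in `]x, y[) `|q t|) ^+ 2 <= (y - x) * \int[mu]_(t in `]x, y[) (q t ^+ 2).
Proof.
move=> qL x1 xy y1; have [? ?] := L2_subitv_integrable qL x1 y1.
exact: sqr_Rintegral_le.
Qed.

Lemma Rintegral_sqr_sub_le q x y : L2 q -> -1 <= x -> x <= y -> y <= 1 ->
  \int[mu]_(t in `]x, y[) (q t ^+ 2) <= \int[mu]_(t in D) (q t ^+ 2).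
Proof.
move=> qL x1 xy y1; have q2 := L2_sqr_integrable qL.
rewrite (Rintegral_itv_split (le_trans x1 xy) y1 q2).
rewrite (Rintegral_itv_split x1 xy (integrable_sub_itv (lexx _) y1 q2)).
have h (a b : R) : 0 <= \int[mu]_(t in `]a, b[) (q t ^+ 2).
  by apply: Rintegral_ge0 => t _; exact: sqr_ge0.
by rewrite addrAC lerDr addr_ge0.
Qed.

Lemma L2_sqr_Rintegral_leD q x y : L2 q -> -1 <= x -> x <= y -> y <= 1 ->
  (\int[mu]_(t in `]x, y[) q t) ^+ 2 <= (y - x) * \int[mu]_(t in D) (q t ^+ 2).
Proof.
move=> qL x1 xy y1; have [qi _] := L2_subitv_integrable qL x1 y1.
apply: (@le_trans _ _ ((\int[mu]_(t in `]x, y[) `|q t|) ^+ 2)).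
  rewrite -(real_normK (num_real (Rintegral _ _ _))) lerXn2r ?nnegrE//.
    by apply: Rintegral_ge0.
  exact: le_normr_Rintegral.
apply: le_trans (L2_sqr_Rintegral_le qL x1 xy y1) _.
by rewrite ler_wpM2l ?subr_ge0// Rintegral_sqr_sub_le.
Qed.

(** Compactly supported test functions do not see the endpoints $\pm1$. The interior identity is
    applied on $[x+s,y-s]$; the two values of [f] move little by continuity, and each omitted
    integral is at most $\sqrt{sQ}$ by Cauchy-Schwarz. *)
Lemma weak_derivative_Rintegral f g x y :
  {within `[-1, 1], continuous f} -> L2 g ->
  weak_derivative f g -> -1 <= x -> x <= y -> y <= 1 ->
  f y - f x = \int[mu]_(t in `]x, y[) g t.
Proof.
move=> fc gL fg x1; rewrite le_eqVlt => /predU1P[<- _|xy y1].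
  by rewrite subrr Rintegral_itv_ge.
set Q := \int[mu]_(t in D) (g t ^+ 2).
have Q0 : 0 <= Q by apply: Rintegral_ge0 => t _; exact: sqr_ge0.
have xI : -1 <= x <= 1 by rewrite x1 (le_trans _ y1)// ltW.
have yI : -1 <= y <= 1 by rewrite y1 (le_trans x1)// ltW.
apply/eqP; rewrite -subr_eq0 -normr_le0; apply/ler_addgt0Pr => e e0; rewrite add0r.
have e4 : 0 < e / 4 by rewrite divr_gt0.
have [a a0 aP] := (within_itv_continuousP _ _ _).1 fc x xI _ e4.
have [b b0 bP] := (within_itv_continuousP _ _ _).1 fc y yI _ e4.
(* Four errors of size $e/4$ are allowed: [a / 2] and [b / 2] serve the continuity of [f] at [x] and
   [y], the last bound makes $sQ\le(e/4)^2$ for the two end integrals, and $(y-x)/2$ keeps the inner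
   interval in order. [Q + 1] avoids dividing by zero. *)
pose s := Num.min (Num.min (a / 2) (b / 2)) (Num.min ((y - x) / 2) ((e / 4) ^+ 2 / (Q + 1))).
have Q1 : 0 < Q + 1 by rewrite ltr_wpDl.
have s0 : 0 < s.
  by rewrite !lt_min !divr_gt0 ?subr_gt0 ?exprn_gt0.
have /and4P[sa sb sxy sQ] :
    [&& s <= a / 2, s <= b / 2, s <= (y - x) / 2 & s <= (e / 4) ^+ 2 / (Q + 1)].
  by rewrite /s !ge_min !lexx ?orbT.
clearbody s.
have sQ2 : s * Q <= (e / 4) ^+ 2.
  move: sQ; rewrite ler_pdivlMr//; apply: le_trans.
  by rewrite ler_wpM2l ?ltW// ltrDl.
have small z : -1 <= z -> z + s <= 1 -> `|\int[mu]_(t in `]z, z + s[) g t| <= e / 4.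
  move=> z1 zs; rewrite -(@ler_pXn2r _ 2)// ?nnegrE ?(ltW e4)//.
  rewrite real_normK ?num_real//; apply: le_trans sQ2.
  have := L2_sqr_Rintegral_leD gL z1 _ zs; rewrite lerDl => /(_ (ltW s0)).
  by rewrite addrAC subrr add0r.
have [gi _] := L2_subitv_integrable gL x1 y1.
have xs : x <= x + s by rewrite lerDl ltW.
have ys : y - s <= y by rewrite lerBlDr lerDl ltW.
have xsy : x + s <= y - s by lra.
rewrite (Rintegral_itv_split xs (le_trans xsy ys) gi).
rewrite (Rintegral_itv_split xsy ys (integrable_sub_itv xs (lexx _) gi)).
have xs1 : -1 < x + s by lra.
have ys1 : y - s < 1 by lra.
rewrite -(weak_derivative_Rintegral_interior fc (L2_integrable gL) fg xs1 xsy ys1).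
have h1 := small x x1 ltac:(lra).
have := small (y - s) ltac:(lra) ltac:(lra); rewrite subrK => h2.
have h3 : `|f x - f (x + s)| <= e / 4.
  by apply: aP; [lra|rewrite opprD addrA subrr sub0r normrN gtr0_norm//; lra].
have h4 : `|f y - f (y - s)| <= e / 4.
  by apply: bP; [lra|rewrite opprB addrC subrK gtr0_norm//; lra].
move: h1 h2 h3 h4; rewrite !ler_norml.
set I1 := Rintegral _ _ _; set I2 := Rintegral _ _ _.
by move=> /andP[? ?] /andP[? ?] /andP[? ?] /andP[? ?]; apply/andP; split; lra.
Qed.

(* Bisecting [x, y] n times improves the bound on Phi x y by the factor 2^-n. *)
Lemma additive_interval_eq0 (Phi Q : R -> R -> R) (C x y : R) : x <= y ->
  (forall s m t, x <= s -> s <= m -> m <= t -> t <= y -> Phi s t = Phi s m + Phi m t) ->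
  (forall s m t, x <= s -> s <= m -> m <= t -> t <= y -> Q s t = Q s m + Q m t) ->
  (forall s t, x <= s -> s <= t -> t <= y -> `|Phi s t| <= C * (t - s) * Q s t) ->
  Phi x y = 0.
Proof.
move=> xy PhiD QD PhiQ.
have key n s t : x <= s -> s <= t -> t <= y ->
    2 ^+ n * `|Phi s t| <= C * (t - s) * Q s t.
  elim: n s t => [|n ih] s t xs st ty; first by rewrite expr0 mul1r PhiQ.
  pose m := (s + t) / 2.
  have sm : s <= m by rewrite /m; lra.
  have mt : m <= t by rewrite /m; lra.
  have h1 := ih s m xs sm (le_trans mt ty).
  have h2 := ih m t (le_trans xs sm) mt ty.
  have mE1 : m - s = (t - s) / 2 by rewrite /m; lra.
  have mE2 : t - m = (t - s) / 2 by rewrite /m; lra.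
  rewrite mE1 in h1; rewrite mE2 in h2.
  rewrite (PhiD s m t)// (QD s m t)// exprS.
  have : 2 ^+ n * `|Phi s m + Phi m t| <= 2 ^+ n * `|Phi s m| + 2 ^+ n * `|Phi m t|.
    by rewrite -mulrDr ler_wpM2l ?ler_normD// exprn_ge0.
  by nra.
apply/eqP; rewrite -normr_le0 leNgt; apply/negP => P0.
set B := C * (y - x) * Q x y in key *.
have [n nB] : exists n : nat, B / `|Phi x y| < n%:R.
  by exists (Num.bound `|B / `|Phi x y| |); rewrite (le_lt_trans (ler_norm _))// archi_boundP.
have := key n x y (lexx _) xy (lexx _); rewrite -/B -ler_pdivlMr// leNgt => /negP; apply.
by rewrite (lt_trans nB)// -natrX ltr_nat ltn_expl.
Qed.

(** Repeats the case distinction of [G], so that for $S\ge0$ identifying the two only takes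
    rewriting the integrand. *)
Definition primitive f t : R :=
  if 0 <= t then \int[mu]_(s in `[0, t]) f s else - \int[mu]_(s in `[t, 0]) f s.

Lemma integrable_continuous_itv f x y : continuous f -> mu.-integrable `]x, y[ (EFin \o f).
Proof.
move=> fc; apply: (@integrableS _ _ _ mu `[x, y]) => //.
  by apply: subset_itv; rewrite bnd_simp.
apply: continuous_compact_integrable; first exact: segment_compact.
exact: continuous_subspaceT.
Qed.

Lemma Rintegral_itv_cc_oo f x y : continuous f ->
  \int[mu]_(t in `[x, y]) f t = \int[mu]_(t in `]x, y[) f t.
Proof.
move=> fc; rewrite -Rintegral_itv_obnd_cbnd; last first.
  apply: (@integrableS _ _ _ mu `[x, y]) => //.
    by apply: subset_itv; rewrite bnd_simp.
  apply: continuous_compact_integrable; first exact: segment_compact.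
  exact: continuous_subspaceT.
rewrite Rintegral_itv_bndo_bndc//; exact: integrable_continuous_itv.
Qed.

Lemma primitiveB f x y : continuous f -> x <= y ->
  primitive f y - primitive f x = \int[mu]_(t in `]x, y[) f t.
Proof.
move=> fc xy; rewrite /primitive !Rintegral_itv_cc_oo//.
have fi a b := integrable_continuous_itv a b fc.
case: ifPn => [y0|]; case: ifPn => [x0|].
- by rewrite (Rintegral_itv_split x0 xy (fi _ _)) addrC addKr.
- rewrite -ltNge => x0; rewrite (Rintegral_itv_split (ltW x0) y0 (fi _ _)).
  by rewrite opprK addrC.
- by rewrite -ltNge => /(le_lt_trans (le_trans x0 xy)); rewrite ltxx.
- move=> x0; rewrite -ltNge => y0.
  by rewrite (Rintegral_itv_split xy (ltW y0) (fi _ _)) opprK addrC addrK.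
Qed.

Lemma lipschitz_continuous f (L : R) :
  (forall a b, `|f a - f b| <= L * `|a - b|) -> continuous f.
Proof.
move=> fL t; apply/cvgrPdist_le => e e0.
have L0 : 0 <= L.
  by have := le_trans (normr_ge0 _) (fL 1 0); rewrite subr0 normr1 mulr1.
have L1 : 0 < L + 1 by rewrite ltr_wpDl.
have eL : 0 < e / (L + 1) by rewrite divr_gt0.
near=> s.
have : `|t - s| <= e / (L + 1).
  by near: s; apply: cvgr_dist_le => //.
rewrite ler_pdivlMr// => h; apply: le_trans (fL _ _) (le_trans _ h).
by rewrite mulrC ler_wpM2l// lerDl.
Unshelve. all: by end_near. Qed.

Lemma lipschitz_comp_within f p (L a b : R) :
  (forall x y, `|f x - f y| <= L * `|x - y|) ->
  {within `[a, b], continuous p} -> {within `[a, b], continuous (f \o p)}.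
Proof.
move=> fL pc; apply/within_itv_continuousP => x xab e e0.
have L0 : 0 <= L.
  by have := le_trans (normr_ge0 _) (fL 1 0); rewrite subr0 normr1 mulr1.
have L1 : 0 < L + 1 by rewrite ltr_wpDl.
have eL : 0 < e / (L + 1) by rewrite divr_gt0.
have [d d0 dP] := (within_itv_continuousP _ _ _).1 pc x xab _ eL.
exists d => // y yab xy; have := dP y yab xy.
rewrite ler_pdivlMr// => h; apply: le_trans (fL _ _) (le_trans _ h).
by rewrite mulrC ler_wpM2l// lerDl.
Qed.

(** Between [a] and [b] the function [f] differs from [f a] by at most $L|b-a|$. The base point may
    be the left or the right end, which [main] covers by admitting any [c] in $[x,y]$. *)
Lemma primitive_quad f (L a b : R) :
  (forall a b, `|f a - f b| <= L * `|a - b|) ->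
  `|primitive f b - primitive f a - f a * (b - a)| <= L * (b - a) ^+ 2.
Proof.
move=> fL; have fc := lipschitz_continuous fL.
have L0 : 0 <= L.
  by have := le_trans (normr_ge0 _) (fL 1 0); rewrite subr0 normr1 mulr1.
have main c x y : x <= y -> x <= c <= y ->
    `|\int[mu]_(t in `]x, y[) f t - f c * (y - x)| <= L * (y - x) ^+ 2.
  move=> xy /andP[xc cy].
  rewrite expr2 mulrA; apply: Rintegral_near_cst => //.
    exact: integrable_continuous_itv.
  move=> t /andP[xt ty]; apply: le_trans (fL _ _) _.
  by rewrite ler_wpM2l// ler_norml; apply/andP; split; lra.
have [ab|/ltW ba] := leP a b; first by rewrite primitiveB// main// lexx.
have := main a b a ba; rewrite ba lexx => /(_ isT); rewrite -primitiveB//.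
rewrite -normrN; set u := primitive f b; set v := primitive f a.
rewrite (_ : - (v - u - _) = u - v - f a * (b - a)); last by ring.
by rewrite (_ : (a - b) ^+ 2 = (b - a) ^+ 2)//; ring.
Qed.

(** On $[s,t]$ put $N=\int|q|$. The increment of the primitive and $\int f(p)q$ both equal
    $f(p(s))(p(t)-p(s))$ up to $LN^2$, and $N^2\le(t-s)\int q^2$. Their difference is additive in
    the interval, so [additive_interval_eq0] with constant $2L$ makes it zero. *)
Lemma primitive_chain_rule f p q (L x y : R) :
  (forall a b, `|f a - f b| <= L * `|a - b|) ->
  {within `[-1, 1], continuous p} -> L2 q ->
  (forall s t, -1 <= s -> s <= t -> t <= 1 -> p t - p s = \int[mu]_(r in `]s, t[) q r) ->
  -1 <= x -> x <= y -> y <= 1 ->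
  primitive f (p y) - primitive f (p x) = \int[mu]_(t in `]x, y[) (f (p t) * q t).
Proof.
move=> fL pc qL pq x1 xy y1.
have fc := lipschitz_continuous fL.
have L0 : 0 <= L.
  by have := le_trans (normr_ge0 _) (fL 1 0); rewrite subr0 normr1 mulr1.
have fpc := lipschitz_comp_within fL pc.
have [M M0 MP] := within_itv_bounded fpc.
have fqD : mu.-integrable D (EFin \o (fun t => f (p t) * q t)).
  apply: (@integrableM_bounded _ D M) => //.
  - exact: (within_itv_measurable fpc).
  - by move=> t; rewrite /= in_itv/= => /andP[? ?]; apply: MP; rewrite !ltW.
  - exact: L2_integrable.
have fqi s t : -1 <= s -> t <= 1 -> mu.-integrable `]s, t[ (EFin \o (fun t => f (p t) * q t)).
  by move=> s1 t1; exact: integrable_sub_itv fqD.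
apply/eqP; rewrite -subr_eq0; apply/eqP.
pose Phi s t := primitive f (p t) - primitive f (p s) - \int[mu]_(r in `]s, t[) (f (p r) * q r).
pose Q s t := \int[mu]_(r in `]s, t[) (q r ^+ 2).
apply: (@additive_interval_eq0 Phi Q (2 * L) x y xy).
- move=> s m t xs sm mt ty; rewrite /Phi.
  rewrite (Rintegral_itv_split sm mt (fqi _ _ (le_trans x1 xs) (le_trans ty y1))).
  by ring.
- move=> s m t xs sm mt ty; apply: Rintegral_itv_split sm mt _.
  by have [] := L2_subitv_integrable qL (le_trans x1 xs) (le_trans ty y1).
move=> s t xs st ty.
have s1 := le_trans x1 xs; have t1 := le_trans ty y1.
have [qi q2i] := L2_subitv_integrable qL s1 t1.
pose N := \int[mu]_(r in `]s, t[) `|q r|.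
have NQ : N ^+ 2 <= (t - s) * Q s t by exact: L2_sqr_Rintegral_le.
have pN r : s <= r -> r <= t -> `|p r - p s| <= N.
  move=> sr rt; rewrite pq// ?(le_trans rt)//.
  have [qi' _] := L2_subitv_integrable qL s1 (le_trans rt t1).
  apply: le_trans (le_normr_Rintegral _ qi') _ => //.
  rewrite /N (Rintegral_itv_split sr rt (integrable_normR _ qi))// lerDl.
  exact: Rintegral_ge0.
have h1 := primitive_quad (p s) (p t) fL.
have h2 : `|\int[mu]_(r in `]s, t[) (f (p r) * q r) - f (p s) * (p t - p s)| <= L * N ^+ 2.
  rewrite pq// -RintegralZl// -RintegralB//; [|exact: fqi|exact: integrableZR].
  have di : mu.-integrable `]s, t[ (EFin \o (fun r => f (p r) * q r - f (p s) * q r)).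
    by apply: integrableBR => //; [exact: fqi|exact: integrableZR].
  apply: le_trans (le_normr_Rintegral _ di) _ => //.
  rewrite expr2 mulrA -RintegralZl//; last exact: integrable_normR.
  apply: le_Rintegral => //; [exact: integrable_normR| |].
    by apply: integrableZR => //; exact: integrable_normR.
  move=> r; rewrite /= in_itv/= => /andP[sr rt].
  rewrite -mulrBl normrM ler_wpM2r// (le_trans (fL _ _))// ler_wpM2l//.
  by apply: pN; exact: ltW.
have h3 : (p t - p s) ^+ 2 <= N ^+ 2.
  rewrite -(real_normK (num_real (p t - p s))) lerXn2r ?nnegrE ?pN//.
  exact: Rintegral_ge0.
have h3' := ler_wpM2l L0 h3; have h4 := ler_wpM2l L0 NQ.
move: h1 h2; rewrite !ler_norml /Phi.
set I := Rintegral _ _ _ => /andP[? ?] /andP[? ?]; apply/andP; split; lra.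
Qed.

End chain_rule.

(** * The energy and the slope bound *)

Section energy.
Context {R : realType}.
Local Notation mu := (@lebesgue_measure R).
Local Notation D := (`]-1, 1[%classic : set R).
Implicit Types (p q : R -> R) (x y s t alpha S : R).

(** For even [f] the first-order terms of $F(r)+F(-r)$ cancel, so its increments are quadratically
    small; the bisection lemma, with interval length in the role of [Q], makes it constant. *)
Lemma primitive_even_odd (f : R -> R) (L t : R) :
  (forall a b, `|f a - f b| <= L * `|a - b|) ->
  (forall s, f (- s) = f s) -> primitive f (- t) = - primitive f t.
Proof.
move=> fL fN.
have p0 : primitive f 0 = 0 by rewrite /primitive lexx set_itv1 Rintegral_set1.
have main s : 0 <= s -> primitive f s + primitive f (- s) = 0.
  move=> s0.
  pose h r := primitive f r + primitive f (- r).
  suff : h s - h 0 = 0 by rewrite /h oppr0 p0 addr0 subr0.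
  apply: (@additive_interval_eq0 _ (fun a b => h b - h a) (fun a b => b - a) (2 * L) 0 s s0).
  - by move=> a m b *; ring.
  - by move=> a m b *; ring.
  move=> a b _ ab _; rewrite -mulrA -expr2.
  have := primitive_quad a b fL; have := primitive_quad (- a) (- b) fL.
  rewrite fN (_ : (- b - - a) ^+ 2 = (b - a) ^+ 2); last by ring.
  rewrite !ler_norml /h => /andP[? ?] /andP[? ?]; apply/andP; split; lra.
have [t0|/ltW t0] := leP 0 t; apply/eqP; rewrite -addr_eq0 addrC; apply/eqP.
  exact: main.
by have := main (- t); rewrite opprK oppr_ge0 addrC; exact.
Qed.

Lemma G_primitive S : 0 <= S -> G S = primitive (fun t : R => kappa t ^+ 5) S.
Proof.
move=> S0; rewrite /G /primitive S0.
by apply: eq_Rintegral => t _; rewrite G_integrandE.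
Qed.

Lemma G_ge0 S : 0 <= S -> 0 <= G S.
Proof.
move=> S0; rewrite G_primitive// /primitive S0.
by apply: Rintegral_ge0 => t _; exact: kappaX_ge0.
Qed.

(** Where $|v'|$ first reaches $S$ the sign of $v'$ is unknown; a negative value is reflected by
    oddness of the primitive. *)
Lemma G_le_norm_primitive S s : 0 <= S -> S <= `|s| ->
  G S <= `|primitive (fun t : R => kappa t ^+ 5) s|.
Proof.
set f := fun t : R => kappa t ^+ 5.
have fL : forall a b, `|f a - f b| <= 5 * `|a - b| by exact: kappaX_lipschitz.
have fc := lipschitz_continuous fL.
have main r : 0 <= S -> S <= r -> G S <= `|primitive f r|.
  move=> S0 Sr; rewrite (le_trans _ (ler_norm _))// G_primitive// -/f -subr_ge0 primitiveB//.
  by apply: Rintegral_ge0 => t _; exact: kappaX_ge0.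
move=> S0; have [s0|s0] := leP 0 s; first by rewrite ger0_norm// => ?; exact: main.
rewrite ltr0_norm// => Ss.
rewrite -[s]opprK (primitive_even_odd _ fL) ?normrN; first exact: main.
by move=> u; rewrite /f /kappa sqrrN.
Qed.

Lemma measurable_kappa_comp p n : measurable_fun D p ->
  measurable_fun D (fun t => kappa (p t) ^+ n).
Proof.
move=> mp; apply: measurable_funX.
by apply: measurableT_comp => //; exact: continuous_measurable_fun kappa_continuous.
Qed.

Lemma measurable_edensity (v p q : R -> R) :
  (forall t, -1 < t < 1 -> 0 < v t) ->
  measurable_fun D v -> measurable_fun D p -> measurable_fun D q ->
  measurable_fun D (fun t => edensity (v t) (p t) (q t)).
Proof.
move=> v0 mv mp mq; apply: measurable_funD.
  apply: measurable_funM; first exact: measurable_kappa_comp.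
  apply: (@eq_measurable_fun _ _ _ _ _ (fun t => v t `^ (-1))).
    by move=> t; rewrite inE/= in_itv/= => tD; rewrite powR_inv1// ltW// v0.
  by apply: (measurableT_comp (measurable_powR _)).
apply: measurable_funM; last exact: measurable_funX.
by apply: measurable_funM => //; exact: measurable_kappa_comp.
Qed.

Lemma integrable_edensity (v p q : R -> R) (c M : R) : 0 < c ->
  (forall t, -1 < t < 1 -> c <= v t <= M) ->
  measurable_fun D v -> measurable_fun D p -> L2 q ->
  mu.-integrable D (EFin \o (fun t => edensity (v t) (p t) (q t))).
Proof.
move=> c0 vb mv mp qL.
have v0 t : -1 < t < 1 -> 0 < v t.
  by move=> /vb /andP[cv _]; exact: lt_le_trans cv.
apply: (@le_integrableR _ D _ (fun t => cst (1 / c) t + M * q t ^+ 2)) => //.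
- by apply: measurable_edensity => //; case: qL.
- move=> t; rewrite /= in_itv/= => tD.
  have /andP[cv vM] := vb t tD; have vt := v0 t tD.
  rewrite ger0_norm; last exact/edensity_ge0/ltW.
  rewrite /edensity lerD//.
    rewrite ler_pM ?kappaX_ge0 ?kappaX_le1 ?invr_ge0 ?(ltW vt)//.
    by rewrite lef_pV2.
  rewrite ler_wpM2r ?sqr_ge0// (le_trans _ vM)//.
  by rewrite ler_piMr ?(ltW vt)// kappaX_le1.
- apply: integrableDR => //; first exact: integrable_cst_itv.
  by apply: integrableZR => //; exact: L2_sqr_integrable.
Qed.

Definition energy (v : H2 R) : R :=
  \int[mu]_(t in D) edensity (v t) (H2_d1 v t) (H2_d2 v t).

Lemma H2_Rintegral (v : H2 R) x y : -1 <= x -> x <= y -> y <= 1 ->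
  v y - v x = \int[mu]_(t in `]x, y[) H2_d1 v t.
Proof.
move=> *; apply: weak_derivative_Rintegral => //.
- exact: H2_fun_cont.
- exact: H2_d1_L2.
- exact: H2_fun_weak.
Qed.

Lemma H2_d1_Rintegral (v : H2 R) x y : -1 <= x -> x <= y -> y <= 1 ->
  H2_d1 v y - H2_d1 v x = \int[mu]_(t in `]x, y[) H2_d2 v t.
Proof.
move=> *; apply: weak_derivative_Rintegral => //.
- exact: H2_d1_cont.
- exact: H2_d2_L2.
- exact: H2_d1_weak.
Qed.

Section admissible_facts.
Variables (alpha : R) (alpha_gt0 : 0 < alpha) (v : H2 R) (vadm : admissible alpha v).
Local Notation p := (H2_d1 v).
Local Notation q := (H2_d2 v).

(** Positivity is assumed only on the open interval; at the ends it comes from the boundary value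
    $\alpha>0$, so the minimum over the closed interval is positive. These bounds depend on [v] and
    serve positivity and integrability; uniform ones come from the energy. *)
Lemma admissible_bounds : exists c M : R, 0 < c /\
  forall t, -1 <= t <= 1 -> c <= v t <= M.
Proof.
have [v0 [va vb] _ _] := vadm.
have m11 : -1 <= 1 :> R by lra.
have [a aI aP] := EVT_min m11 (@H2_fun_cont R v).
have [M M0 MP] := within_itv_bounded (@H2_fun_cont R v).
exists (v a), M; split; last first.
  by move=> t tI; rewrite aP ?in_itv// (le_trans (ler_norm _))// MP.
move: aI; rewrite in_itv/= => /andP[].
rewrite le_eqVlt => /predU1P[<-|a1]; first by rewrite vb.
by rewrite le_eqVlt => /predU1P[->|a2]; rewrite ?va// v0// in_itv/= a1.
Qed.

Lemma admissible_gt0 t : -1 <= t <= 1 -> 0 < v t.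
Proof.
have [c [M [c0 vb]]] := admissible_bounds.
by move=> /vb /andP[cv _]; exact: lt_le_trans cv.
Qed.

Lemma admissible_integrable_edensity :
  mu.-integrable D (EFin \o (fun t => edensity (v t) (p t) (q t))).
Proof.
have [c [M [c0 vb]]] := admissible_bounds.
apply: (@integrable_edensity _ _ _ c M) => //.
- by move=> t /andP[? ?]; apply: vb; rewrite !ltW.
- by have [] := H2_fun_L2 v.
- by have [] := H2_d1_L2 v.
- exact: H2_d2_L2.
Qed.

Lemma energy_ge0 : 0 <= energy v.
Proof.
apply: Rintegral_ge0 => t; rewrite /= in_itv/= => /andP[? ?].
by apply/edensity_ge0/ltW/admissible_gt0; rewrite !ltW.
Qed.

Lemma integrable_kappa_d2 n :
  mu.-integrable D (EFin \o (fun t => kappa (p t) ^+ n * q t)).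
Proof.
apply: (@integrableM_bounded _ D 1) => //.
- by apply: measurable_kappa_comp; have [] := H2_d1_L2 v.
- by move=> t _; rewrite ger0_norm ?kappaX_ge0 ?kappaX_le1.
- exact/L2_integrable/H2_d2_L2.
Qed.

Lemma kappa_chain_rule n x y : -1 <= x -> x <= y -> y <= 1 ->
  primitive (fun t => kappa t ^+ n) (p y) - primitive (fun t => kappa t ^+ n) (p x) =
  \int[mu]_(t in `]x, y[) (kappa (p t) ^+ n * q t).
Proof.
move=> *; apply: (@primitive_chain_rule _ (fun t => kappa t ^+ n) p q n%:R) => //.
- by move=> a b; exact: kappaX_lipschitz.
- exact: H2_d1_cont.
- exact: H2_d2_L2.
- exact: H2_d1_Rintegral.
Qed.

(* The mixed term is the derivative of a function of [v'], which vanishes at both ends. *)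
Lemma WillmoreE : Willmore v = (pi / 2 * energy v)%:E.
Proof.
have [_ _ [p1 pN1] _] := vadm.
have m11 : -1 <= 1 :> R by lra.
have cross : \int[mu]_(t in D) (2 * (kappa (p t) ^+ 6 * q t)) = 0.
  rewrite RintegralZl//; last exact: integrable_kappa_d2.
  by rewrite -kappa_chain_rule// p1 pN1 subrr mulr0.
have ei := admissible_integrable_edensity.
have ci : mu.-integrable D (EFin \o (fun t => 2 * (kappa (p t) ^+ 6 * q t))).
  by apply: integrableZR => //; exact: integrable_kappa_d2.
rewrite /Willmore [RHS]EFinM; congr (_ * _)%E.
transitivity (\int[mu]_(t in D)
    (edensity (v t) (p t) (q t) - 2 * (kappa (p t) ^+ 6 * q t))%:E)%E.
  apply: eq_integral => t; rewrite inE/= in_itv/= => /andP[? ?].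
  by rewrite willmore_integrandE// admissible_gt0// !ltW.
rewrite -[energy v]subr0 -cross -RintegralB// /Rintegral fineK//.
by apply: (@integrable_fin_num _ _ _ mu D) => //; exact: integrableBR.
Qed.

(** By evenness, the forward increment of [v] from [y] and its backward increment from [- y] are
    opposite; divided by the step they approximate [p y] and [p (- y)]. To the right of $1$ there is
    no room for a step, and there the condition $v'(\pm1)=0$ takes over. *)
Lemma admissible_d1_odd x : -1 <= x <= 1 -> p (- x) = - p x.
Proof.
have [_ _ [p1 pN1] vE] := vadm.
have main y : -1 <= y < 1 -> p (- y) = - p y.
  move=> /andP[y1 y2]; apply/eqP; rewrite -addr_eq0 -normr_le0.
  apply/ler_addgt0Pr => e e0; rewrite add0r.
  have e2 : 0 < e / 2 by rewrite divr_gt0.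
  have [a a0 aP] := (within_itv_continuousP _ _ _).1 (@H2_d1_cont R v) y ltac:(lra) _ e2.
  have [b b0 bP] := (within_itv_continuousP _ _ _).1 (@H2_d1_cont R v) (- y) ltac:(lra) _ e2.
  have [s [s0 sa sb sy]] : exists s, [/\ 0 < s, s < a, s < b & y + s <= 1].
    pose s := Num.min (Num.min (a / 2) (b / 2)) (1 - y).
    have s0 : 0 < s by rewrite !lt_min !divr_gt0 ?subr_gt0.
    have /and3P[h1 h2 h3] : [&& s <= a / 2, s <= b / 2 & s <= 1 - y].
      by rewrite /s !ge_min !lexx ?orbT.
    by clearbody s; exists s; split; lra.
  have pi (c d : R) : -1 <= c -> d <= 1 -> mu.-integrable `]c, d[ (EFin \o p).
    by move=> c1 d1; have [] := L2_subitv_integrable (H2_d1_L2 v) c1 d1.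
  have h1 : `|v (y + s) - v y - p y * (y + s - y)| <= e / 2 * (y + s - y).
    rewrite (H2_Rintegral v y1 _ sy); last by lra.
    apply: Rintegral_near_cst; [lra|exact: pi|].
    move=> t /andP[ty ts]; rewrite distrC; apply: aP; first by lra.
    by rewrite ler0_norm; lra.
  have h2 : `|v (- y) - v (- y - s) - p (- y) * (- y - (- y - s))| <= e / 2 * (- y - (- y - s)).
    rewrite H2_Rintegral; [|lra..].
    apply: Rintegral_near_cst; [lra|apply: pi; lra|].
    move=> t /andP[ty ts]; rewrite distrC; apply: bP; first by lra.
    by rewrite gtr0_norm; lra.
  have E1 : v (y + s) = v (- y - s) by rewrite vE ?opprD// in_itv/=; lra.
  have E2 : v y = v (- y) by rewrite vE// in_itv/=; lra.
  rewrite -(ler_pM2r s0) -{1}(gtr0_norm s0) -normrM.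
  move: h1 h2; rewrite !ler_norml E1 E2 => /andP[? ?] /andP[? ?].
  by apply/andP; split; lra.
move=> /andP[x1]; rewrite le_eqVlt => /predU1P[->|x2].
  by rewrite p1 pN1 oppr0.
by apply: main; rewrite x1.
Qed.

(** Cauchy-Schwarz for $z=k(v')^5v''$, since $vz^2$ is the second term of the density; the first
    term is nonnegative and dropped. The condition $b-a\le1$ absorbs the length factor. *)
Lemma energy_segment_ge (a b c m : R) : -1 <= a -> a <= b -> b <= 1 -> b - a <= 1 ->
  0 <= c -> (forall t, a < t < b -> c <= v t) -> 0 <= m ->
  m <= `|primitive (fun t => kappa t ^+ 5) (p b) - primitive (fun t => kappa t ^+ 5) (p a)| ->
  c * m ^+ 2 <= \int[mu]_(t in `]a, b[) edensity (v t) (p t) (q t).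
Proof.
move=> a1 ab b1 ba c0 vc m0; rewrite kappa_chain_rule//.
pose z t := kappa (p t) ^+ 5 * q t.
have zi : mu.-integrable `]a, b[ (EFin \o z).
  exact: integrable_sub_itv a1 b1 (integrable_kappa_d2 5).
have z2i : mu.-integrable `]a, b[ (EFin \o (fun t => z t ^+ 2)).
  apply: integrable_sub_itv a1 b1 _.
  apply: (@le_integrableR _ D _ (fun t => q t ^+ 2)) => //.
  - apply: measurable_funX; apply: integrable_measurable; exact: integrable_kappa_d2.
  - move=> t _; rewrite ger0_norm ?sqr_ge0// /z exprMn ler_piMl ?sqr_ge0//.
    by rewrite -exprM kappaX_le1.
  - exact/L2_sqr_integrable/H2_d2_L2.
move=> mz.
have h1 : m ^+ 2 <= \int[mu]_(t in `]a, b[) (z t ^+ 2).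
  apply: (@le_trans _ _ ((\int[mu]_(t in `]a, b[) `|z t|) ^+ 2)).
    rewrite lerXn2r ?nnegrE//; first exact: Rintegral_ge0.
    apply: le_trans mz _; exact: le_normr_Rintegral.
  apply: le_trans (sqr_Rintegral_le ab zi z2i) _.
  by rewrite ler_piMl//; apply: Rintegral_ge0 => t _; exact: sqr_ge0.
apply: le_trans (ler_wpM2l c0 h1) _.
rewrite -RintegralZl//; apply: le_Rintegral => //.
- exact: integrableZR.
- exact: integrable_sub_itv a1 b1 admissible_integrable_edensity.
move=> t; rewrite /= in_itv/= => /andP[ta tb].
have v0 : 0 < v t by apply: admissible_gt0; apply/andP; split; lra.
rewrite /edensity (_ : z t ^+ 2 = kappa (p t) ^+ 10 * q t ^+ 2); last first.
  by rewrite /z exprMn -exprM.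
apply: (@le_trans _ _ (v t * kappa (p t) ^+ 10 * q t ^+ 2)).
  rewrite -mulrA; apply: ler_wpM2r; last by apply: vc; rewrite ta.
  by rewrite (mulr_ge0 (kappaX_ge0 _ _) (sqr_ge0 _)).
by rewrite lerDr divr_ge0 ?kappaX_ge0// ltW.
Qed.

End admissible_facts.

(** [y] is the infimum of the points of $[-1,x]$ where $|p|\ge S$. If $|p(y)|<S$, continuity would
    keep $|p|<S$ slightly to the right of [y], against the choice of the infimum. *)
Lemma first_crossing p S x : {within `[-1, 1], continuous p} ->
  -1 <= x <= 1 -> S <= `|p x| ->
  exists2 y, -1 <= y <= x & S <= `|p y| /\ forall t, -1 <= t < y -> `|p t| < S.
Proof.
move=> pc xI Sx.
pose A := [set t | -1 <= t <= x /\ S <= `|p t|].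
have Ax : A x by split=> //; have /andP[-> _] := xI; rewrite lexx.
have hA : has_inf A.
  by split; [exists x|exists (-1) => t [/andP[]]].
pose y := inf A.
have yx : y <= x by apply: ge_inf => //; exact: hA.2.
have y1 : -1 <= y by apply: lb_le_inf => [|t [/andP[]]//]; exists x.
have yI : -1 <= y <= 1 by rewrite y1 (le_trans yx)//; case/andP: xI.
exists y; first by rewrite y1.
split; last first.
  move=> t /andP[t1 ty]; rewrite ltNge; apply/negP => St.
  have : y <= t.
    apply: ge_inf; first exact: hA.2.
    by split=> //; rewrite t1 (le_trans (ltW ty)).
  by rewrite leNgt ty.
rewrite leNgt; apply/negP => yS.
have e0 : 0 < (S - `|p y|) / 2 by rewrite divr_gt0// subr_gt0.
have [d d0 dP] := (within_itv_continuousP _ _ _).1 pc y yI _ e0.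
have [t [/andP[t1 tx] St] ty] := inf_adherent d0 hA.
have yt : y <= t by apply: ge_inf; [exact: hA.2|split=> //; rewrite t1].
have := dP t _ _; rewrite t1 (le_trans tx)//; last by case/andP: xI.
move=> /(_ isT); rewrite -/y in ty; rewrite ler0_norm ?opprB ?subr_le0//.
rewrite ltrBlDl ty => /(_ isT) h.
have := ler_normD (p y) (p t - p y); rewrite addrC subrK distrC => h2.
move: (`|p y|) (`|p t|) h h2 St yS => *; lra.
Qed.

(** Oddness of $v'$ lets the crossing [y] be taken in $[-1,0]$; then $]-1,y[$ and $]-y,1[$ are
    disjoint and have length at most 1. On each, the slope is 0 at one end and at least $S$ in
    modulus at the other, which costs $(\alpha-S)G(S)^2$. *)
Lemma admissible_energy_ge alpha S x (v : H2 R) : 0 < alpha -> admissible alpha v ->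
  0 <= S <= alpha -> -1 <= x <= 1 -> S <= `|H2_d1 v x| ->
  2 * g alpha S <= energy v.
Proof.
move=> alpha0 va /andP[S0 Sa] xI Sx.
have [_ [v1 vN1] [p1 pN1] _] := va.
set p := H2_d1 v in Sx p1 pN1 *.
have [x' x'I Sx'] : exists2 x', -1 <= x' <= 0 & S <= `|p x'|.
  have /andP[xl xr] := xI.
  have [x0|x0] := leP x 0; first by exists x => //; rewrite xl.
  exists (- x); first by apply/andP; split; lra.
  by rewrite /p (admissible_d1_odd va)// normrN.
have [y /andP[y1 yx'] [Sy yP]] :=
  first_crossing (@H2_d1_cont R v) (ltac:(lra) : -1 <= x' <= 1) Sx'.
have y0 : y <= 0 by lra.
have pS t : -1 < t < y -> `|p t| <= S.
  by move=> /andP[? ?]; apply/ltW/yP; rewrite ltW.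
have pS' t : - y < t < 1 -> `|p t| <= S.
  move=> tI; rewrite -[t]opprK /p (admissible_d1_odd va) ?normrN; last by lra.
  by apply: pS; lra.
have pint (c d : R) : -1 <= c -> d <= 1 -> mu.-integrable `]c, d[ (EFin \o p).
  by move=> c1 d1; have [] := L2_subitv_integrable (H2_d1_L2 v) c1 d1.
(* Starting from $v(-1)=\alpha$ with slope at most $S$ over a length at most 1, [v] loses at most
   $S$. *)
have vl t : -1 < t < y -> alpha - S <= v t.
  move=> /andP[t1 ty].
  have h : `|v t - v (-1)| <= S.
    rewrite (H2_Rintegral v (lexx _)); [|lra..].
    have := @Rintegral_near_cst _ p (-1) t 0 S (ltW t1) (pint _ _ (lexx _) _).
    rewrite mul0r subr0 => /(_ ltac:(lra)) h; apply: le_trans (h _) _.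
      by move=> s /andP[? ?]; rewrite subr0; apply: pS; lra.
    by rewrite ler_piMr//; lra.
  by move: h; rewrite vN1 ler_norml => /andP[? ?]; lra.
have vr t : - y < t < 1 -> alpha - S <= v t.
  move=> /andP[t1 ty].
  have h : `|v 1 - v t| <= S.
    rewrite H2_Rintegral; [|lra..].
    have := @Rintegral_near_cst _ p t 1 0 S (ltW ty) (pint _ _ _ (lexx _)).
    rewrite mul0r subr0 => /(_ ltac:(lra)) h; apply: le_trans (h _) _.
      by move=> s /andP[? ?]; rewrite subr0; apply: pS'; lra.
    by rewrite ler_piMr//; lra.
  by move: h; rewrite v1 ler_norml => /andP[? ?]; lra.
have prim0 : primitive (fun t : R => kappa t ^+ 5) 0 = 0.
  by rewrite /primitive lexx set_itv1 Rintegral_set1.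
have e1 := @energy_segment_ge alpha alpha0 v va (-1) y (alpha - S) (G S) (lexx _) y1
  ltac:(lra) ltac:(lra) ltac:(lra) vl (G_ge0 S0).
rewrite -/p pN1 prim0 subr0 in e1; have {}e1 := e1 (G_le_norm_primitive S0 Sy).
have e2 := @energy_segment_ge alpha alpha0 v va (- y) 1 (alpha - S) (G S) ltac:(lra)
  ltac:(lra) (lexx _) ltac:(lra) ltac:(lra) vr (G_ge0 S0).
rewrite -/p p1 prim0 sub0r normrN in e2.
have Sy' : S <= `|p (- y)| by rewrite /p (admissible_d1_odd va) ?normrN//; lra.
have {}e2 := e2 (G_le_norm_primitive S0 Sy').
have ei := admissible_integrable_edensity alpha0 va.
rewrite /energy (Rintegral_itv_split y1 (ltac:(lra) : y <= 1) ei).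
rewrite (@Rintegral_itv_split _ _ y 1 (- y)); [|lra|lra|]; last first.
  exact: (integrable_sub_itv y1 (lexx _) ei).
have e3 : 0 <= \int[mu]_(t in `]y, (- y)[) edensity (v t) (p t) (H2_d2 v t).
  apply: Rintegral_ge0 => t; rewrite /= in_itv/= => /andP[? ?].
  by apply/edensity_ge0/ltW/(admissible_gt0 alpha0 va); apply/andP; split; lra.
rewrite /g mulrDl mul1r lerD//.
by rewrite (le_trans e2)// lerDr.
Qed.

End energy.

(** * Square integrable functions *)

Section L2_completeness.
Context {R : realType}.
Local Notation mu := (@lebesgue_measure R).
Local Notation D := (`]-1, 1[%classic : set R).
Implicit Types (p q f : R -> R).

Lemma L2_lin q f (a b : R) : L2 q -> L2 f -> L2 (fun t => a * q t + b * f t).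
Proof.
move=> qL fL; have [mq q2] := qL; have [mf f2] := fL; split.
  by apply: measurable_funD; apply: measurable_funM.
apply: (@le_integrableR _ D (fun t => (a * q t + b * f t) ^+ 2)
   (fun t => (2 * a ^+ 2) * q t ^+ 2 + (2 * b ^+ 2) * f t ^+ 2)) => //.
- by apply: measurable_funX; apply: measurable_funD; apply: measurable_funM.
- move=> t _; rewrite ger0_norm ?sqr_ge0// -subr_ge0.
  rewrite (_ : _ - _ = (a * q t - b * f t) ^+ 2) ?sqr_ge0//; ring.
- by apply: integrableDR => //; apply: integrableZR.
Qed.

(** The Riesz-Fischer argument with weights: $\int2^kr_k^2\le C4^{-k}$ is summable, so
    $T=\sum2^kr_k^2$ is integrable and finite almost everywhere. There
    $|r_k|\le\frac12(2^{-k}+2^kr_k^2)$ makes the increments summable and bounds all $q_k$ at once;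
    this majorant is what dominated convergence needs later. *)
Lemma L2_fast_cauchy (q_ : nat -> R -> R) (C : R) : (forall k, L2 (q_ k)) ->
  (forall k, \int[mu]_(t in D) ((q_ k.+1 t - q_ k t) ^+ 2) <= C * (1 / 8) ^+ k) ->
  exists h H : R -> R, [/\ measurable_fun D h, mu.-integrable D (EFin \o H),
    {ae mu, forall t, D t -> q_ k t @[k --> \oo] --> h t} &
    {ae mu, forall t, D t -> forall k, `|q_ k t| <= H t}].
Proof.
move=> qL qC.
pose r k t := q_ k.+1 t - q_ k t.
pose a k t := 2 ^+ k * r k t ^+ 2.
have mD : measurable D by [].
have rL k : L2 (r k).
  have := L2_lin 1 (-1) (qL k.+1) (qL k).
  by rewrite (_ : (fun t => _) = r k)//; apply/funext => t; rewrite /r mul1r mulN1r.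
have r2i k := L2_sqr_integrable (rL k).
have ai k : mu.-integrable D (EFin \o a k) by apply: integrableZR.
have a0 k t : 0 <= a k t by rewrite mulr_ge0 ?sqr_ge0// exprn_ge0.
have ma k : measurable_fun D (EFin \o a k) by exact: (measurable_int mu).
have Ia k : (\int[mu]_(t in D) (a k t)%:E <= (C * (1 / 4) ^+ k)%:E)%E.
  have -> : (\int[mu]_(t in D) (a k t)%:E)%E = (\int[mu]_(t in D) a k t)%:E.
    by rewrite /Rintegral fineK//; apply: (@integrable_fin_num _ _ _ mu D mD _ (ai k)).
  rewrite lee_fin RintegralZl//.
  apply: (le_trans (ler_wpM2l _ (qC k))); first by rewrite exprn_ge0.
  rewrite mulrCA -exprMn (_ : 2 * (1 / 8) = 1 / 4 :> R)//; by field.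
have C0 : 0 <= C.
  have := qC 0%N; rewrite expr0 mulr1; apply: le_trans.
  by apply: Rintegral_ge0 => t _; exact: sqr_ge0.
pose T t := (\sum_(k <oo) (a k t)%:E)%E.
have mT : measurable_fun D T.
  apply: (@ge0_emeasurable_sum _ _ _ D (fun k t => (a k t)%:E) xpredT).
    by move=> k t Dt _; rewrite lee_fin; exact: a0.
  by move=> k _; exact: ma.
have T0 t : (0 <= T t)%E by apply: nneseries_ge0 => k _ _; rewrite lee_fin.
have IT : (\int[mu]_(t in D) T t <= (2 * C)%:E)%E.
  rewrite integral_nneseries//; last by move=> k t _; rewrite lee_fin.
  apply: lime_le.
    by apply: is_cvg_nneseries => k _ _; apply: integral_ge0 => t _; rewrite lee_fin.
  apply: nearW => n.
  apply: (@le_trans _ _ (\sum_(0 <= k < n) (C * (1 / 4) ^+ k)%:E)%E).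
    by apply: lee_sum => k _; exact: Ia.
  rewrite sumEFin lee_fin -mulr_sumr mulrC ler_wpM2r//.
  have : \sum_(0 <= k < n) (1 / 4 : R) ^+ k <= 2 - 2 * (1 / 4) ^+ n.
    elim: n => [|n ih]; first by rewrite big_geq// expr0; lra.
    rewrite big_nat_recr//= exprS.
    have : 0 <= (1 / 4 : R) ^+ n by rewrite exprn_ge0.
    by move: ih; set s := \sum_(_ <= _ < _) _; set b := (1 / 4) ^+ n => *; lra.
  move/le_trans; apply; have : 0 <= (1 / 4 : R) ^+ n by rewrite exprn_ge0.
  by lra.
have Ti : mu.-integrable D T.
  apply/integrableP; split => //.
  apply: le_lt_trans (ltry (2 * C)); apply: le_trans IT.
  rewrite le_eqVlt; apply/orP; left; apply/eqP/eq_integral => t _.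
  by rewrite gee0_abs.
(* The constant 1 is half of $\sum2^{-k}$. [fine] sends an infinite value of [T] to 0, which happens
   only on a null set. *)
pose H t := `|q_ 0%N t| + (cst 1 t + 2^-1 * fine (T t)).
(* An upper limit is measurable without any convergence; it agrees with the limit wherever [T] is
   finite. *)
pose h t := fine (limn_esup (fun k => (q_ k t)%:E)).
have Tfin : {ae mu, forall t, D t -> T t \is a fin_num} by exact: integrable_ae.
have sumb n : \sum_(k < n) (1 / 2 : R) ^+ k <= 2.
  have : \sum_(k < n) (1 / 2 : R) ^+ k <= 2 - 2 * (1 / 2) ^+ n.
    elim: n => [|n ih]; first by rewrite big_ord0 expr0; lra.
    rewrite big_ord_recr//= exprS.
    by move: ih; set s := \sum_(_ < _) _; set b := (1 / 2) ^+ n => *; lra.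
  move/le_trans; apply; have : 0 <= (1 / 2 : R) ^+ n by rewrite exprn_ge0.
  by lra.
have rsum t n : T t \is a fin_num -> \sum_(k < n) `|r k t| <= 1 + 2^-1 * fine (T t).
  move=> Tf.
  have Tn : \sum_(k < n) a k t <= fine (T t).
    rewrite -lee_fin fineK// -sumEFin -(big_mkord xpredT (fun k => (a k t)%:E)).
    by apply: nneseries_lim_ge => k _; rewrite lee_fin.
  apply: (@le_trans _ _ (\sum_(k < n) (2^-1 * (1 / 2) ^+ k + 2^-1 * a k t))).
    apply: ler_sum => k _; rewrite /a -(real_normK (num_real (r k t))).
    have b0 : 0 < (2 : R) ^+ k by rewrite exprn_gt0.
    rewrite expr_div_n expr1n -subr_ge0.
    rewrite (_ : _ - _ = 2^-1 * (1 / 2 ^+ k) * (2 ^+ k * `|r k t| - 1) ^+ 2); last first.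
      by field; rewrite gt_eqF.
    by rewrite mulr_ge0 ?sqr_ge0// mulr_ge0// divr_ge0// ltW.
  rewrite big_split/= -!mulr_sumr lerD//.
    by have := sumb n; lra.
  by rewrite ler_wpM2l.
have qE t n : q_ n t = q_ 0%N t + \sum_(k < n) r k t.
  elim: n => [|n ih]; first by rewrite big_ord0 addr0.
  by rewrite big_ord_recr/= addrA -ih /r addrC subrK.
have qcvg t : T t \is a fin_num -> q_ k t @[k --> \oo] --> h t.
  move=> Tf.
  have cv : cvgn (series (r^~ t)).
    apply: normed_cvg; apply: nondecreasing_is_cvgn.
      by apply: nondecreasing_series => *; rewrite ?normr_ge0.
    exists (1 + 2^-1 * fine (T t)) => _ [n _ <-].
    by rewrite /normed_series_of/= seriesEord; exact: rsum.
  have cq : q_ k t @[k --> \oo] --> q_ 0%N t + limn (series (r^~ t)).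
    have -> : (fun k => q_ k t) = (fun k => q_ 0%N t + series (r^~ t) k).
      by apply/funext => n; rewrite qE /series/= big_mkord.
    by apply: cvgD => //; exact: cvg_cst.
  have cq' : (q_ k t)%:E @[k --> \oo] --> (q_ 0%N t + limn (series (r^~ t)))%:E.
    by apply: cvg_EFin; [exact: nearW|exact: cq].
  by rewrite /h (cvg_limn_einf_sup cq').2.
exists h, H; split.
- apply: measurableT_comp => //; apply: measurable_fun_limn_esup => k.
  by apply/measurable_EFinP; have [] := qL k.
- apply: integrableDR => //.
    by apply: integrable_normR => //; exact: L2_integrable.
  apply: integrableDR => //; first exact: integrable_cst_itv.
  apply: integrableZR => //.
  apply: le_integrable Ti => //.
    by apply: measurableT_comp => //; apply: measurableT_comp.
  move=> t _ /=; rewrite gee0_abs//.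
  move: (T0 t); case: (T t) => [s| |]//=.
    by rewrite !lee_fin => s0; rewrite ger0_norm.
  by move=> _; rewrite normr0 leey.
- by apply: ae_imply Tfin => t + Dt => /(_ Dt); exact: qcvg.
- apply: ae_imply Tfin => t + Dt k => /(_ Dt) Tf.
  rewrite qE /H (le_trans (ler_normD _ _))// lerD2l.
  by rewrite (le_trans (ler_norm_sum _ _ _))// rsum.
Qed.

End L2_completeness.

(** * Limits *)

Section limits.
Context {R : realType}.
Local Notation mu := (@lebesgue_measure R).
Local Notation D := (`]-1, 1[%classic : set R).

(* Ascoli's theorem: along an ultrafilter pointwise limits exist, and they are
   uniform by equicontinuity. *)
Lemma ultra_uniform_limit (T : Type) (F : set_system T) (w : T -> R -> R) (B K : R) :
  UltraFilter F ->
  (\forall v \near F, forall x, -1 <= x <= 1 -> `|w v x| <= B) ->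
  (\forall v \near F, forall x y, -1 <= x <= 1 -> -1 <= y <= 1 ->
    (w v x - w v y) ^+ 2 <= K * `|x - y|) ->
  exists u : R -> R, forall e, 0 < e ->
    \forall v \near F, forall x, -1 <= x <= 1 -> `|w v x - u x| <= e.
Proof.
move=> UF wB wK.
have lim x : -1 <= x <= 1 -> exists l : R, forall e, 0 < e ->
    \forall v \near F, `|w v x - l| <= e.
  move=> xI.
  have [|l [_ lc]] := @segment_compact R (- B) B ((w^~ x) @ F).
    by apply: filterS wB => v /(_ x xI); rewrite ler_norml /= in_itv.
  exists l => e e0.
  have [//|nF] := in_ultra_setVsetC [set v | `|w v x - l| <= e] UF.
  exfalso.
  have [|z [/= h1 h2]] := lc (~` [set z | `|z - l| <= e]) [set z | `|z - l| <= e] nF.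
    apply/nbhs_ballP; exists e => //= z; rewrite /ball/= distrC; exact: ltW.
  exact: h1.
have [u uP] : exists u : R -> R, forall x, -1 <= x <= 1 -> forall e, 0 < e ->
    \forall v \near F, `|w v x - u x| <= e.
  have /choice[u uP] : forall x, exists l : R, -1 <= x <= 1 -> forall e, 0 < e ->
      \forall v \near F, `|w v x - l| <= e.
    move=> x; have [xI|xI] := boolP (-1 <= x <= 1); last by exists 0.
    by have [l lP] := lim x xI; exists l.
  by exists u.
have uK x y : -1 <= x <= 1 -> -1 <= y <= 1 -> forall e, 0 < e -> K * `|x - y| <= e ^+ 2 ->
    `|u x - u y| <= e + e + e.
  move=> xI yI e e0 Ke.
  have : \forall v \near F, `|u x - u y| <= e + e + e.
    near=> v.
    have h1 : `|w v x - u x| <= e by near: v; exact: uP.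
    have h2 : `|w v y - u y| <= e by near: v; exact: uP.
    have h3 : `|w v x - w v y| <= e.
      rewrite -(@ler_pXn2r _ 2)// ?nnegrE ?(ltW e0)// real_normK ?num_real//.
      apply: le_trans Ke.
      have : forall x y, -1 <= x <= 1 -> -1 <= y <= 1 ->
        (w v x - w v y) ^+ 2 <= K * `|x - y| by near: v.
      exact.
    move: h1 h2 h3; rewrite !ler_norml => /andP[? ?] /andP[? ?] /andP[? ?].
    by apply/andP; split; lra.
  by move=> /filter_ex[].
exists u => e e0.
(* Compactness in covering form: the local bounds, each valid on a neighbourhood of [x] and a member
   of [F], combine into one member of [F] valid at all points. Five ninths of [e] are spent: one at
   [x], one on the variation of [w v], three on that of [u]. *)
have ncov : near_covering (`[(-1)%R, 1%R]%classic : set R).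
  by apply/compact_near_coveringP; exact: segment_compact.
have e3 : 0 < e / 9 by rewrite divr_gt0.
pose P v x := -1 <= x <= 1 -> `|w v x - u x| <= e.
have : \near F, `[(-1)%R, 1%R]%classic `<=` P F.
  apply: ncov => x; rewrite /= in_itv/= => xI.
  have K1 : 0 < `|K| + 1 by rewrite ltr_wpDl.
  exists ([set y | `|x - y| < (e / 9) ^+ 2 / (`|K| + 1)],
    [set v | `|w v x - u x| <= e / 9 /\ forall x y, -1 <= x <= 1 -> -1 <= y <= 1 ->
        (w v x - w v y) ^+ 2 <= K * `|x - y|]).
    split; last by apply: filterI => //; exact: uP.
    apply/nbhs_ballP; exists ((e / 9) ^+ 2 / (`|K| + 1)) => //=.
    by rewrite divr_gt0// exprn_gt0.
  move=> [y v] [/= xy [h1 h2]] yI.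
  have Kxy : K * `|x - y| <= (e / 9) ^+ 2.
    move: xy; rewrite ltr_pdivlMr// => /ltW; apply: le_trans.
    by rewrite mulrC ler_wpM2l// (le_trans (ler_norm _))// lerDl.
  have h3 := uK x y xI yI _ e3 Kxy.
  have h4 : `|w v x - w v y| <= e / 9.
    rewrite -(@ler_pXn2r _ 2)// ?nnegrE ?(ltW e3)// real_normK ?num_real//.
    exact: le_trans (h2 x y xI yI) Kxy.
  move: h1 h3 h4; rewrite !ler_norml => /andP[? ?] /andP[? ?] /andP[? ?].
  by apply/andP; split; lra.
by apply: filterS => v h x xI; apply: h => //; rewrite /= in_itv.
Unshelve. all: by end_near. Qed.

Lemma uniform_limit_within (w : nat -> R -> R) (u : R -> R) (e : nat -> R) :
  (forall d, 0 < d -> exists n, e n <= d) ->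
  (forall n, {within `[-1, 1], continuous (w n)}) ->
  (forall n x, -1 <= x <= 1 -> `|w n x - u x| <= e n) ->
  {within `[-1, 1], continuous u}.
Proof.
move=> e0 wc wu; apply/within_itv_continuousP => x xI d d0.
have d3 : 0 < d / 3 by rewrite divr_gt0.
have [n en] := e0 _ d3.
have [r r0 rP] := (within_itv_continuousP _ _ _).1 (wc n) x xI _ d3.
exists r => // y yI xy.
have := rP y yI xy; have := wu n x xI; have := wu n y yI.
rewrite !ler_norml => /andP[? ?] /andP[? ?] /andP[? ?].
by apply/andP; split; lra.
Qed.

Lemma test_function_bounded (phi : R -> R) : test_function phi ->
  [/\ measurable_fun D phi, measurable_fun D (derive1 phi) &
    exists2 M, 0 < M & forall t, D t -> `|phi t| <= M /\ `|derive1 phi t| <= M].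
Proof.
move=> [dphi cdphi _].
have cphi : continuous phi.
  by move=> t; apply/differentiable_continuous/derivable1_diffP.
have [M1 M10 M1P] := @within_itv_bounded R (-1) 1 phi (continuous_subspaceT cphi).
have [M2 M20 M2P] := @within_itv_bounded R (-1) 1 _ (continuous_subspaceT cdphi).
split; first by apply: measurable_funTS; exact: continuous_measurable_fun.
  by apply: measurable_funTS; exact: continuous_measurable_fun.
exists (M1 + M2); first by rewrite addr_gt0.
move=> t; rewrite /= in_itv/= => /andP[? ?].
have tI : -1 <= t <= 1 by rewrite !ltW.
have := M1P t tI; have := M2P t tI; split; lra.
Qed.

(** A test function and its derivative are bounded on [D], so that bound times [F] and [H] dominates
    the two integrands of the defining identity, which therefore passes to the limit. *)
Lemma dominated_weak_derivative (f_ g_ : nat -> R -> R) (f g F H : R -> R) :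
  (forall n, measurable_fun D (f_ n)) -> (forall n, measurable_fun D (g_ n)) ->
  measurable_fun D f -> measurable_fun D g ->
  {ae mu, forall t, D t -> f_ n t @[n --> \oo] --> f t} ->
  {ae mu, forall t, D t -> g_ n t @[n --> \oo] --> g t} ->
  {ae mu, forall t, D t -> forall n, `|f_ n t| <= F t} ->
  {ae mu, forall t, D t -> forall n, `|g_ n t| <= H t} ->
  mu.-integrable D (EFin \o F) -> mu.-integrable D (EFin \o H) ->
  (forall n, weak_derivative (f_ n) (g_ n)) -> weak_derivative f g.
Proof.
move=> mf_ mg_ mf mg ff gg fF gH iF iH fg phi tphi.
have [mphi mdphi [M M0 MP]] := test_function_bounded tphi.
have conv (k_ : nat -> R -> R) (k K psi : R -> R) : (forall n, measurable_fun D (k_ n)) ->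
    measurable_fun D k -> measurable_fun D psi -> (forall t, D t -> `|psi t| <= M) ->
    {ae mu, forall t, D t -> k_ n t @[n --> \oo] --> k t} ->
    {ae mu, forall t, D t -> forall n, `|k_ n t| <= K t} ->
    mu.-integrable D (EFin \o K) ->
    (\int[mu]_(t in D) (k_ n t * psi t)) @[n --> \oo] --> \int[mu]_(t in D) (k t * psi t).
  move=> mk_ mk mpsi psiM kk kK iK.
  have [] // := @Rdominated_convergence _ D (fun n t => k_ n t * psi t)
    (fun t => k t * psi t) (fun t => M * K t).
  - by move=> n; apply: measurable_funM.
  - by apply: measurable_funM.
  - apply: ae_imply kk => t h Dt; apply: cvgM; [exact: h|exact: cvg_cst].
  - apply: ae_imply kK => t h Dt n; rewrite normrM mulrC.
    by rewrite ler_pM ?psiM ?h.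
  - exact: integrableZR.
have c1 := conv _ _ _ _ mf_ mf mdphi (fun t Dt => (MP t Dt).2) ff fF iF.
have c2 := cvgN (conv _ _ _ _ mg_ mg mphi (fun t Dt => (MP t Dt).1) gg gH iH).
have E : (fun n => \int[mu]_(t in D) (f_ n t * derive1 phi t)) =
    (fun n => - (\int[mu]_(t in D) (g_ n t * phi t))).
  by apply/funext => n; exact: fg.
rewrite E in c1; have := cvg_unique _ c1 (c2 _); apply; exact: norm_hausdorff.
Qed.

End limits.

(** * Midpoints *)

Section average.
Context {R : realType}.
Local Notation mu := (@lebesgue_measure R).
Local Notation D := (`]-1, 1[%classic : set R).
Implicit Types (f g p q : R -> R).

Lemma within_itv_lin (x y a b : R) f g : {within `[x, y], continuous f} ->
  {within `[x, y], continuous g} -> {within `[x, y], continuous (fun t => a * f t + b * g t)}.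
Proof.
move=> fc gc; apply/within_itv_continuousP => t tI e e0.
have A0 : 0 < `|a| + 1 by rewrite ltr_wpDl.
have B0 : 0 < `|b| + 1 by rewrite ltr_wpDl.
have ea : 0 < e / 2 / (`|a| + 1) by rewrite !divr_gt0.
have eb : 0 < e / 2 / (`|b| + 1) by rewrite !divr_gt0.
have [r r0 rP] := (within_itv_continuousP _ _ _).1 fc t tI _ ea.
have [s s0 sP] := (within_itv_continuousP _ _ _).1 gc t tI _ eb.
exists (Num.min r s); first by rewrite lt_min r0.
move=> u uI; rewrite lt_min => /andP[ur us].
have := rP u uI ur; have := sP u uI us; rewrite !ler_pdivlMr// => h1 h2.
rewrite (_ : _ - _ = a * (f t - f u) + b * (g t - g u)); last by ring.
rewrite (le_trans (ler_normD _ _))// !normrM.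
have := normr_ge0 (f t - f u); have := normr_ge0 (g t - g u).
by move: h1 h2; nra.
Qed.

Lemma weak_derivative_lin (a b : R) f1 g1 f2 g2 : L2 f1 -> L2 g1 -> L2 f2 -> L2 g2 ->
  weak_derivative f1 g1 -> weak_derivative f2 g2 ->
  weak_derivative (fun t => a * f1 t + b * f2 t) (fun t => a * g1 t + b * g2 t).
Proof.
move=> f1L g1L f2L g2L w1 w2 phi tphi.
have [mphi mdphi [M M0 MP]] := test_function_bounded tphi.
have lin (k l psi : R -> R) : L2 k -> L2 l -> measurable_fun D psi ->
    (forall t, D t -> `|psi t| <= M) ->
    \int[mu]_(t in D) ((a * k t + b * l t) * psi t) =
    a * (\int[mu]_(t in D) (k t * psi t)) + b * (\int[mu]_(t in D) (l t * psi t)).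
  move=> kL lL mpsi psiM.
  have ki (r : R -> R) : L2 r -> mu.-integrable D (EFin \o (fun t => r t * psi t)).
    move=> rL; have := integrableM_bounded (measurable_itv _) mpsi psiM (L2_integrable rL).
    by apply: eq_integrable => // t _; rewrite /= mulrC.
  rewrite -!RintegralZl//; [|exact: ki..].
  rewrite -RintegralD//; [|by apply: integrableZR => //; exact: ki..].
  by apply: eq_Rintegral => t _; ring.
rewrite !lin//; last 2 first.
- by move=> t /MP[].
- by move=> t /MP[].
by rewrite w1// w2//; ring.
Qed.

(** The chosen versions of the second derivative are averaged pointwise, so that the parallelogram
    identity applies at every point. *)
Definition H2_average (v w : H2 R) : H2 R := MkH2
  (@within_itv_lin (-1) 1 (2^-1) (2^-1) _ _ (@H2_fun_cont R v) (@H2_fun_cont R w))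
  (@within_itv_lin (-1) 1 (2^-1) (2^-1) _ _ (@H2_d1_cont R v) (@H2_d1_cont R w))
  (L2_lin (2^-1)%R (2^-1)%R (H2_fun_L2 v) (H2_fun_L2 w))
  (L2_lin (2^-1)%R (2^-1)%R (H2_d1_L2 v) (H2_d1_L2 w))
  (L2_lin (2^-1)%R (2^-1)%R (H2_d2_L2 v) (H2_d2_L2 w))
  (@weak_derivative_lin (2^-1) (2^-1) _ _ _ _
     (H2_fun_L2 v) (H2_d1_L2 v) (H2_fun_L2 w) (H2_d1_L2 w)
     (@H2_fun_weak R v) (@H2_fun_weak R w))
  (@weak_derivative_lin (2^-1) (2^-1) _ _ _ _
     (H2_d1_L2 v) (H2_d2_L2 v) (H2_d1_L2 w) (H2_d2_L2 w)
     (@H2_d1_weak R v) (@H2_d1_weak R w)).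

Lemma admissible_obstacle_average alpha psi (v w : H2 R) :
  admissible_obstacle alpha psi v -> admissible_obstacle alpha psi w ->
  admissible_obstacle alpha psi (H2_average v w).
Proof.
move=> [[v0 [v1 vN1] [p1 pN1] vE] vpsi] [[w0 [w1 wN1] [r1 rN1] wE] wpsi].
split; last by move=> x xI /=; have := vpsi x xI; have := wpsi x xI; lra.
split=> /=.
- by move=> x xI; have := v0 x xI; have := w0 x xI; lra.
- by split; lra.
- by split; lra.
- by move=> x xI; rewrite vE// wE.
Qed.

Lemma midpoint_dist (x y e : R) : `|x - y| <= 2 * e ->
  `|2^-1 * x + 2^-1 * y - x| <= e /\ `|2^-1 * x + 2^-1 * y - y| <= e.
Proof.
by rewrite !ler_norml => /andP[? ?]; split; apply/andP; split; lra.
Qed.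

Lemma midpoint_norm (x y e : R) : `|x| <= e -> `|y| <= e ->
  `|2^-1 * x + 2^-1 * y| <= e.
Proof.
by rewrite !ler_norml => /andP[? ?] /andP[? ?]; apply/andP; split; lra.
Qed.

(** The densities of [v] and [w] are moved to the midpoint pair $(u,u')$, at distance at most [eta],
    by [edensity_lipschitz]. There the parallelogram identity isolates $(v''-w'')^2$ with weight
    $u\,k(u')^{10}/4\ge c\,k(S)^{10}/4$. The error $L\eta(1+(v''^2+w''^2)/2)$ integrates to at most
    $L\eta(2+C_0)$, 2 being the length of the interval; the separate [eta] is the excess of the two
    energies over [Emin]. *)
Lemma energy_gap_le (alpha c M S C0 eta Emin : R) (v w : H2 R) :
  0 < alpha -> 0 < c -> admissible alpha v -> admissible alpha w ->
  (forall x, -1 <= x <= 1 -> c <= v x <= M) ->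
  (forall x, -1 <= x <= 1 -> c <= w x <= M) ->
  (forall x, -1 <= x <= 1 -> `|H2_d1 v x| <= S) ->
  (forall x, -1 <= x <= 1 -> `|H2_d1 w x| <= S) ->
  \int[mu]_(t in D) (H2_d2 v t ^+ 2) <= C0 ->
  \int[mu]_(t in D) (H2_d2 w t ^+ 2) <= C0 ->
  (forall x, -1 <= x <= 1 -> `|v x - w x| <= 2 * eta) ->
  (forall x, -1 <= x <= 1 -> `|H2_d1 v x - H2_d1 w x| <= 2 * eta) ->
  admissible alpha (H2_average v w) ->
  Emin <= energy (H2_average v w) ->
  energy v <= Emin + eta -> energy w <= Emin + eta ->
  c * kappa S ^+ 10 / 4 * \int[mu]_(t in D) ((H2_d2 v t - H2_d2 w t) ^+ 2) <=
  eta + (2 / c + 1 / c ^+ 2 + 1 + 10 * M) * eta * (2 + C0).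
Proof.
move=> alpha0 c0 va wa vb wb pS rS qC sC vw pr ua uE vE wE.
set u := H2_average v w in ua uE *.
set L := 2 / c + _ + _ + _.
set b := c * kappa S ^+ 10 / 4.
have dL : L2 (fun t => H2_d2 v t - H2_d2 w t).
  have := L2_lin 1 (-1) (H2_d2_L2 v) (H2_d2_L2 w).
  rewrite (_ : (fun t => _) = (fun t => H2_d2 v t - H2_d2 w t))//.
  by apply/funext => t; rewrite mul1r mulN1r.
have d2i := L2_sqr_integrable dL.
have q2i := L2_sqr_integrable (H2_d2_L2 v); have s2i := L2_sqr_integrable (H2_d2_L2 w).
have vi := admissible_integrable_edensity alpha0 va.
have wi := admissible_integrable_edensity alpha0 wa.
have ui := admissible_integrable_edensity alpha0 ua.
have mD : measurable D by [].
have a1 := integrableZR 2^-1 mD vi; have a2 := integrableZR 2^-1 mD wi.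
have a12 := integrableDR mD a1 a2.
have b1 := integrableZR (L * eta / 2) mD q2i; have b2 := integrableZR (L * eta / 2) mD s2i.
have b12 := integrableDR mD b1 b2.
have kb := integrableDR mD (integrable_cst_itv (-1) 1 (L * eta)) b12.
have bd := integrableZR b mD d2i.
have key : \int[mu]_(t in D) (edensity (u t) (H2_d1 u t) (H2_d2 u t) +
      b * (H2_d2 v t - H2_d2 w t) ^+ 2) <=
    \int[mu]_(t in D) ((2^-1 * edensity (v t) (H2_d1 v t) (H2_d2 v t) +
      2^-1 * edensity (w t) (H2_d1 w t) (H2_d2 w t)) +
      (cst (L * eta) t + (L * eta / 2 * H2_d2 v t ^+ 2 + L * eta / 2 * H2_d2 w t ^+ 2))).
  apply: le_Rintegral => //.
  - exact: integrableDR.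
  - exact: integrableDR.
  move=> t Dt; have tI : -1 <= t <= 1.
    by move: Dt; rewrite /= in_itv/= => /andP[? ?]; rewrite !ltW.
  have /andP[cv vM] := vb t tI; have /andP[cw wM] := wb t tI.
  have uc : c <= u t by rewrite /u/=; lra.
  have uM : u t <= M by rewrite /u/=; lra.
  have [uv uw] : `|u t - v t| <= eta /\ `|u t - w t| <= eta by exact/midpoint_dist/vw.
  have [up ur] : `|H2_d1 u t - H2_d1 v t| <= eta /\ `|H2_d1 u t - H2_d1 w t| <= eta.
    exact/midpoint_dist/pr.
  have uS : `|H2_d1 u t| <= S by apply: midpoint_norm; [exact: pS|exact: rS].
  have h1 := edensity_lipschitz (H2_d2 v t) c0 uc uM cv uv up.
  have h2 := edensity_lipschitz (H2_d2 w t) c0 uc uM cw uw ur.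
  have h3 := edensity_parallelogram (u t) (H2_d1 u t) (H2_d2 v t) (H2_d2 w t).
  have h4 : b * (H2_d2 v t - H2_d2 w t) ^+ 2 <=
      u t * kappa (H2_d1 u t) ^+ 10 * ((H2_d2 v t - H2_d2 w t) ^+ 2 / 4).
    rewrite /b -mulrA (mulrC 4^-1); apply: ler_wpM2r.
      by rewrite divr_ge0// sqr_ge0.
    apply: ler_pM => //; [exact: ltW|exact: kappaX_ge0|].
    rewrite lerXn2r ?nnegrE ?kappa_ge0//; apply: kappa_le.
    by rewrite (le_trans uS)// ler_norm.
  have E : H2_d2 u t = (H2_d2 v t + H2_d2 w t) / 2 by rewrite /u/=; field.
  rewrite -/L in h1 h2; rewrite E (_ : cst (L * eta) t = L * eta)//.
  move: h1 h2 h3 h4.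
  set e1 := edensity _ _ _; set e2 := edensity _ _ _; set e3 := edensity _ _ _.
  set e4 := edensity _ _ _; set e5 := edensity _ _ _.
  set z := u t * _ * _; set y := b * _; set Q := H2_d2 v t ^+ 2; set T := H2_d2 w t ^+ 2.
  set l := L * eta; move: e1 e2 e3 e4 e5 z y Q T l => *; nra.
move: key.
rewrite (@RintegralD _ _ _ mu D _ _ mD ui bd) (@RintegralD _ _ _ mu D _ _ mD a12 kb).
rewrite (@RintegralD _ _ _ mu D _ _ mD a1 a2).
rewrite (@RintegralD _ _ _ mu D _ _ mD (integrable_cst_itv _ _ _) b12).
rewrite (@RintegralD _ _ _ mu D _ _ mD b1 b2).
rewrite Rintegral_itv_cst; last by lra.
rewrite !RintegralZl//.
rewrite -/(energy u) -/(energy v) -/(energy w).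
have L0 : 0 <= L * eta.
  have e0 : 0 <= eta by have := le_trans (normr_ge0 _) (vw 0 ltac:(lra)); lra.
  have M0 : 0 <= M by have /andP[? ?] := vb 0 ltac:(lra); lra.
  apply: mulr_ge0 => //.
  by rewrite !addr_ge0// ?divr_ge0 ?exprn_ge0 ?(ltW c0)// mulr_ge0.
have l0 : 0 <= L * eta / 2 by rewrite divr_ge0.
by have := ler_wpM2l l0 qC; have := ler_wpM2l l0 sC; move: uE vE wE; lra.
Qed.

End average.

(** * Minimization *)

Section minimization.
Context {R : realType}.
Local Notation mu := (@lebesgue_measure R).
Local Notation D := (`]-1, 1[%classic : set R).

Lemma edensity_cvg (v p q : nat -> R) (a b d : R) : a != 0 ->
  v n @[n --> \oo] --> a -> p n @[n --> \oo] --> b -> q n @[n --> \oo] --> d ->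
  edensity (v n) (p n) (q n) @[n --> \oo] --> edensity a b d.
Proof.
move=> a0 va pb qd.
have kX m : kappa (p n) ^+ m @[n --> \oo] --> kappa b ^+ m.
  elim: m => [|m ih]; first by under eq_cvg do rewrite expr0; rewrite expr0; exact: cvg_cst.
  under eq_cvg do rewrite exprS; rewrite exprS; apply: cvgM => //.
  by apply: continuous_cvg pb; exact: kappa_continuous.
apply: cvgD.
  by apply: cvgM; [exact: kX|exact: cvgV].
apply: cvgM; first by apply: cvgM => //; exact: kX.
by under eq_cvg do rewrite expr2; rewrite expr2; exact: cvgM.
Qed.

(** The slope bound is the contrapositive of [admissible_energy_ge]. Integrating it from $-1$ over
    at most unit length, and symmetry, bound [v]; then $v\,k(v')^{10}\ge(\alpha-S)k(S)^{10}$ turns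
    the energy into control of $v''$. *)
Lemma energy_lt_bounds (alpha S : R) (v : H2 R) : 0 < alpha -> 0 <= S <= alpha ->
  admissible alpha v -> energy v < 2 * g alpha S ->
  [/\ forall x, -1 <= x <= 1 -> `|H2_d1 v x| <= S,
      forall x, -1 <= x <= 1 -> alpha - S <= v x <= alpha + S &
      (alpha - S) * kappa S ^+ 10 * \int[mu]_(t in D) (H2_d2 v t ^+ 2) <= 2 * g alpha S].
Proof.
move=> alpha0 Sal va vE.
have pS x : -1 <= x <= 1 -> `|H2_d1 v x| <= S.
  move=> xI; rewrite leNgt; apply/negP => /ltW Sx.
  by have := admissible_energy_ge alpha0 va Sal xI Sx; rewrite leNgt vE.
have /andP[S0 Sa] := Sal.
have [_ [v1 vN1] _ vev] := va.
have left x : -1 <= x <= 0 -> alpha - S <= v x <= alpha + S.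
  move=> /andP[x1 x0].
  have [pi _] := L2_subitv_integrable (H2_d1_L2 v) (lexx (-1)) (le_trans x0 ler01).
  have h : `|v x - v (-1)| <= S.
    rewrite (H2_Rintegral v (lexx _) x1); last by lra.
    have := @Rintegral_near_cst _ (H2_d1 v) (-1) x 0 S x1 pi.
    rewrite mul0r subr0 => h; apply: le_trans (h _) _.
      by move=> s /andP[? ?]; rewrite subr0; apply: pS; lra.
    by rewrite ler_piMr//; lra.
  by move: h; rewrite vN1 ler_norml => /andP[? ?]; apply/andP; split; lra.
have vS x : -1 <= x <= 1 -> alpha - S <= v x <= alpha + S.
  move=> xI; have [x0|x0] := leP x 0; first by apply: left; lra.
  by rewrite vev ?in_itv//=; apply: left; lra.
split => //; apply: le_trans (ltW vE).
have ei := admissible_integrable_edensity alpha0 va.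
have q2i := L2_sqr_integrable (H2_d2_L2 v).
rewrite -RintegralZl//; apply: le_Rintegral => //; first exact: integrableZR.
move=> t; rewrite /= in_itv/= => /andP[t1 t2].
have tI : -1 <= t <= 1 by rewrite !ltW.
have /andP[cv _] := vS t tI.
apply: (@le_trans _ _ (v t * kappa (H2_d1 v t) ^+ 10 * H2_d2 v t ^+ 2)).
  apply: ler_wpM2r; first exact: sqr_ge0.
  apply: ler_pM => //; [by rewrite subr_ge0|exact: kappaX_ge0|].
  rewrite lerXn2r ?nnegrE ?kappa_ge0//; apply: kappa_le.
  by rewrite (le_trans (pS t tI))// ler_norm.
by rewrite /edensity lerDr divr_ge0 ?kappaX_ge0// ltW// (admissible_gt0 alpha0 va).
Qed.

Lemma energy_min_exists (alpha S Emin : R) (psi : R -> R) : 0 < alpha -> 0 <= S <= alpha ->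
  (forall v, admissible_obstacle alpha psi v -> Emin <= energy v) ->
  (forall e, 0 < e -> exists2 v, admissible_obstacle alpha psi v & energy v < Emin + e) ->
  Emin < 2 * g alpha S ->
  exists2 u, admissible_obstacle alpha psi u & energy u <= Emin.
Proof.
move=> alpha0 Sal Elb Einf Eg.
have /andP[S0 Sa] := Sal.
have E0 : 0 <= Emin.
  rewrite leNgt; apply/negP => El.
  have [|v [va _]] := Einf (- Emin); first by rewrite oppr_gt0.
  by rewrite subrr ltNge (energy_ge0 alpha0 va).
(* If $S=\alpha$, then $g_\alpha(S)=0$ and [Eg] would make [Emin] negative. *)
have c0 : 0 < alpha - S.
  rewrite lt_neqAle subr_ge0 Sa andbT eq_sym; apply/eqP => aS.
  by move: Eg; rewrite /g aS mul0r mulr0 ltNge E0.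
set c := alpha - S in c0; set M := alpha + S.
pose gap := 2 * g alpha S - Emin.
have gap0 : 0 < gap by rewrite subr_gt0.
have b0 : 0 < c * kappa S ^+ 10 by rewrite mulr_gt0// exprn_gt0// kappa_gt0.
pose C0 := 2 * g alpha S / (c * kappa S ^+ 10).
have ctl v : admissible_obstacle alpha psi v -> energy v < Emin + gap ->
  [/\ forall x, -1 <= x <= 1 -> `|H2_d1 v x| <= S,
      forall x, -1 <= x <= 1 -> c <= v x <= M &
      \int[mu]_(t in D) (H2_d2 v t ^+ 2) <= C0].
  move=> [va _]; rewrite /gap addrC subrK => vE.
  have [h1 h2 h3] := energy_lt_bounds alpha0 Sal va vE.
  by split => //; rewrite ler_pdivlMr// mulrC.
have C00 : 0 <= C0 by rewrite divr_ge0 ?(ltW b0)//; lra.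
(* The sets of near-minimizers generate a proper filter; an ultrafilter above it replaces the
   extraction of subsequences. *)
pose A e := [set v | admissible_obstacle alpha psi v /\ energy v < Emin + e].
pose F0 := filter_from [set e | 0 < e] A.
have F0P : ProperFilter F0.
  apply: filter_from_proper; last first.
    by move=> e /= e0; have [v v1 v2] := Einf e e0; exists v.
  apply: filter_from_filter; first by exists 1 => /=.
  move=> e1 e2 /= e10 e20; exists (Num.min e1 e2); first by rewrite /= lt_min e10.
  move=> v [va vE]; split; split => //; apply: (lt_le_trans vE).
    by rewrite lerD2l ge_min lexx.
  by rewrite lerD2l ge_min lexx orbT.
have [F [UF F0F]] := ultraFilterLemma F0P.
have FA e : 0 < e -> F (A e) by move=> e0; apply: F0F; exists e.
have [u uP] : exists u : R -> R, forall e, 0 < e ->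
    \forall v \near F, forall x, -1 <= x <= 1 -> `|(v : H2 R) x - u x| <= e.
  (* The slope bound is put in the form of a squared modulus: $(S(y-x))^2\le2S^2(y-x)$ because
     $y-x\le2$. *)
  apply: (@ultra_uniform_limit _ _ F (fun v => H2_fun v) M (2 * S ^+ 2)).
    apply: filterS (FA _ gap0) => v [va vE] x xI.
    have [_ vb _] := ctl v va vE; have /andP[h1 h2] := vb x xI.
    by rewrite ger0_norm// (le_trans _ h1)// ltW.
  apply: filterS (FA _ gap0) => v [va vE].
  have [pS _ _] := ctl v va vE.
  have main x y : -1 <= x -> x <= y -> y <= 1 -> (v y - v x) ^+ 2 <= 2 * S ^+ 2 * (y - x).
    move=> x1 xy y1; rewrite H2_Rintegral//.
    have [pi _] := L2_subitv_integrable (H2_d1_L2 v) x1 y1.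
    have := @Rintegral_near_cst _ (H2_d1 v) x y 0 S xy pi.
    rewrite mul0r subr0 => /(_ _) h.
    have {}h : `|\int[mu]_(t in `]x, y[) H2_d1 v t| <= S * (y - x).
      by apply: h => t /andP[? ?]; rewrite subr0; apply: pS; lra.
    rewrite -(real_normK (num_real (Rintegral _ _ _))).
    apply: (@le_trans _ _ ((S * (y - x)) ^+ 2)).
      by rewrite lerXn2r ?nnegrE// mulr_ge0// subr_ge0.
    rewrite exprMn (_ : 2 * S ^+ 2 * (y - x) = S ^+ 2 * (2 * (y - x))); last by ring.
    by apply: ler_wpM2l; [exact: sqr_ge0|nra].
  move=> x y xI yI; have [xy|/ltW xy] := leP x y.
    rewrite -sqrrN opprB distrC ger0_norm ?subr_ge0//.
    apply: main => //; [by case/andP: xI|by case/andP: yI].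
  by rewrite ger0_norm ?subr_ge0//; apply: main => //; [case/andP: yI|case/andP: xI].
have [d dP] : exists d : R -> R, forall e, 0 < e ->
    \forall v \near F, forall x, -1 <= x <= 1 -> `|H2_d1 v x - d x| <= e.
  apply: (@ultra_uniform_limit _ _ F (fun v => H2_d1 v) S C0).
    apply: filterS (FA _ gap0) => v [va vE].
    by have [pS _ _] := ctl v va vE.
  apply: filterS (FA _ gap0) => v [va vE].
  have [_ _ qC] := ctl v va vE.
  have main x y : -1 <= x -> x <= y -> y <= 1 -> (H2_d1 v y - H2_d1 v x) ^+ 2 <= C0 * (y - x).
    move=> x1 xy y1; rewrite H2_d1_Rintegral//.
    apply: le_trans (L2_sqr_Rintegral_leD (H2_d2_L2 v) x1 xy y1) _.
    by rewrite mulrC ler_wpM2r// subr_ge0.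
  move=> x y xI yI; have [xy|/ltW xy] := leP x y.
    rewrite -sqrrN opprB distrC ger0_norm ?subr_ge0//.
    apply: main => //; [by case/andP: xI|by case/andP: yI].
  by rewrite ger0_norm ?subr_ge0//; apply: main => //; [case/andP: yI|case/andP: xI].
(* [energy_gap_le] bounds $\int(v_{k+1}''-v_k'')^2$ linearly in [eta k], and $8^{-k}$ is the decay
   that [L2_fast_cauchy] asks for. *)
pose eta k : R := (1 / 8) ^+ k.
have eta0 k : 0 < eta k by rewrite exprn_gt0.
have etaS k : eta k.+1 <= eta k.
  by rewrite /eta exprS ler_piMl ?exprn_ge0//; lra.
have eta_cvg e : 0 < e -> \forall k \near \oo, eta k < e.
  move=> e0.
  have := @cvgr_lt _ _ _ _ _ _ (@cvg_expr R (1 / 8) _) e; apply => //.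
  by rewrite ger0_norm//; lra.
(* Each requirement holds on a member of [F], so for every [k] a common element exists. *)
have /choice[v_ vP] : forall k, exists v : H2 R,
    [/\ admissible_obstacle alpha psi v, energy v < Emin + gap, energy v < Emin + eta k,
        forall x, -1 <= x <= 1 -> `|v x - u x| <= eta k &
        forall x, -1 <= x <= 1 -> `|H2_d1 v x - d x| <= eta k].
  move=> k.
  have [v [[va vg] [[_ ve] [vu vd]]]] := filter_ex (filterI (FA _ gap0)
    (filterI (FA _ (eta0 k)) (filterI (uP _ (eta0 k)) (dP _ (eta0 k))))).
  by exists v.
have va k : admissible_obstacle alpha psi (v_ k) by have [] := vP k.
have vE k : energy (v_ k) < Emin + eta k by have [] := vP k.
have vu k x : -1 <= x <= 1 -> `|v_ k x - u x| <= eta k by have [_ _ _ + _] := vP k; apply.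
have vd k x : -1 <= x <= 1 -> `|H2_d1 (v_ k) x - d x| <= eta k by have [_ _ _ _] := vP k; apply.
have pS k x : -1 <= x <= 1 -> `|H2_d1 (v_ k) x| <= S.
  by have [v1 v2 _ _ _] := vP k; have [+ _ _] := ctl _ v1 v2; apply.
have vb k x : -1 <= x <= 1 -> c <= v_ k x <= M.
  by have [v1 v2 _ _ _] := vP k; have [_ + _] := ctl _ v1 v2; apply.
have qC k : \int[mu]_(t in D) (H2_d2 (v_ k) t ^+ 2) <= C0.
  by have [v1 v2 _ _ _] := vP k; have [] := ctl _ v1 v2.
have lim_le (a b : R) : (forall k, a <= b + eta k) -> a <= b.
  move=> ab; apply/ler_addgt0Pr => e e0.
  have [k ek] := filter_ex (eta_cvg e e0).
  by rewrite (le_trans (ab k))// lerD2l ltW.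
have lim_eq (a b : R) : (forall k, `|a - b| <= eta k + eta k) -> a = b.
  move=> ab; apply/eqP; rewrite -subr_eq0 -normr_le0; apply/ler_addgt0Pr => e e0.
  have e2 : 0 < e / 2 by rewrite divr_gt0.
  have [k ek] := filter_ex (eta_cvg _ e2).
  by rewrite (le_trans (ab k))//; lra.
have [h [H [mh Hi qh qH]]] : exists h H : R -> R, [/\ measurable_fun D h,
    mu.-integrable D (EFin \o H),
    {ae mu, forall t, D t -> H2_d2 (v_ k) t @[k --> \oo] --> h t} &
    {ae mu, forall t, D t -> forall k, `|H2_d2 (v_ k) t| <= H t}].
  pose L := 2 / c + 1 / c ^+ 2 + 1 + 10 * M.
  apply: (@L2_fast_cauchy _ (fun k => H2_d2 (v_ k))
    ((1 + L * (2 + C0)) / (c * kappa S ^+ 10 / 4))).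
    by move=> k; exact: H2_d2_L2.
  move=> k; have b40 : 0 < c * kappa S ^+ 10 / 4 by rewrite divr_gt0.
  rewrite mulrAC ler_pdivlMr// mulrC.
  have aa := admissible_obstacle_average (va k.+1) (va k).
  apply: le_trans (@energy_gap_le _ alpha c M S C0 (eta k) Emin (v_ k.+1) (v_ k)
    alpha0 c0 (va _).1 (va _).1 (vb _) (vb _) (pS _) (pS _) (qC _) (qC _) _ _ aa.1 _ _ _) _.
  - move=> x xI; have := vu k.+1 x xI; have := vu k x xI; have := etaS k.
    by rewrite !ler_norml => ? /andP[? ?] /andP[? ?]; apply/andP; split; lra.
  - move=> x xI; have := vd k.+1 x xI; have := vd k x xI; have := etaS k.
    by rewrite !ler_norml => ? /andP[? ?] /andP[? ?]; apply/andP; split; lra.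
  - exact: Elb.
  - by have := vE k.+1; have := etaS k; lra.
  - exact: ltW.
  - by rewrite -/L /eta; lra.
have mD : measurable D by [].
have inI t : D t -> -1 <= t <= 1 by rewrite /= in_itv/= => /andP[? ?]; rewrite !ltW.
have eta_small e : 0 < e -> exists n, eta n <= e.
  by move=> e0; have [n /ltW ne] := filter_ex (eta_cvg e e0); exists n.
have uc : {within `[-1, 1], continuous u}.
  apply: (@uniform_limit_within _ (fun n => H2_fun (v_ n)) u eta) => // n.
  exact: H2_fun_cont.
have dc : {within `[-1, 1], continuous d}.
  apply: (@uniform_limit_within _ (fun n => H2_d1 (v_ n)) d eta) => // n.
  exact: H2_d1_cont.
have cL2 (f : R -> R) : {within `[-1, 1], continuous f} -> L2 f.
  move=> fc; have mf := within_itv_measurable fc; split => //.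
  have [B B0 BP] := within_itv_bounded fc.
  apply: (@integrable_bounded _ _ _ (B ^+ 2)); first exact: measurable_funX.
  move=> t /andP[? ?]; rewrite normrX lerXn2r ?nnegrE ?(ltW B0)//.
  by apply: BP; rewrite !ltW.
have near_cvg (w : nat -> R) a : (forall k, `|w k - a| <= eta k) -> w k @[k --> \oo] --> a.
  move=> wa; apply/cvgrPdist_le => e e0; apply: filterS (eta_cvg e e0) => k ek.
  by rewrite distrC (le_trans (wa k))// ltW.
have vu_cvg t : D t -> v_ k t @[k --> \oo] --> u t.
  by move=> Dt; apply: near_cvg => k; apply: vu; exact: inI.
have vd_cvg t : D t -> H2_d1 (v_ k) t @[k --> \oo] --> d t.
  by move=> Dt; apply: near_cvg => k; apply: vd; exact: inI.
have mv k : measurable_fun D (v_ k) by have [] := H2_fun_L2 (v_ k).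
have mp k : measurable_fun D (H2_d1 (v_ k)) by have [] := H2_d1_L2 (v_ k).
have mq k : measurable_fun D (H2_d2 (v_ k)) by have [] := H2_d2_L2 (v_ k).
have mu_ := within_itv_measurable uc; have md := within_itv_measurable dc.
(* The majorant [H] is integrable but not known to be square integrable; Fatou with the uniform
   bound [C0] gives what is needed. *)
have hL : L2 h.
  split => //.
  have [] // := @Rfatou _ D (fun k t => H2_d2 (v_ k) t ^+ 2) (fun t => h t ^+ 2) C0 mD.
  - by move=> n; apply: measurable_funX.
  - exact: measurable_funX.
  - apply: ae_imply qh => t qh Dt; under eq_cvg do rewrite expr2; rewrite expr2.
    by apply: cvgM; exact: qh.
  - by move=> n t _; exact: sqr_ge0.
  - by move=> t _; exact: sqr_ge0.
  - by move=> n; exact/L2_sqr_integrable/H2_d2_L2.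
  - by move=> e e0; apply: nearW => n; rewrite (le_trans (qC n))// lerDl ltW.
have pSae : {ae mu, forall t, D t -> forall k, `|H2_d1 (v_ k) t| <= cst S t}.
  by apply: aeW => t Dt k; apply: pS; exact: inI.
have uw : weak_derivative u d.
  apply: (@dominated_weak_derivative _ (fun k => H2_fun (v_ k)) (fun k => H2_d1 (v_ k))
    u d (cst M) (cst S)) => //.
  - by apply: aeW => t Dt; exact: vu_cvg.
  - by apply: aeW => t Dt; exact: vd_cvg.
  - apply: aeW => t Dt k; have /andP[v1 v2] := vb k t (inI t Dt).
    by rewrite ger0_norm// (le_trans _ v1)// ltW.
  - exact: integrable_cst_itv.
  - exact: integrable_cst_itv.
  - by move=> n; exact: H2_fun_weak.
have dw : weak_derivative d h.
  apply: (@dominated_weak_derivative _ (fun k => H2_d1 (v_ k)) (fun k => H2_d2 (v_ k))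
    d h (cst S) H) => //.
  - by apply: aeW => t Dt; exact: vd_cvg.
  - exact: integrable_cst_itv.
  - by move=> n; exact: H2_d1_weak.
pose U := MkH2 uc dc (cL2 _ uc) (cL2 _ dc) hL uw dw.
(* Strict positivity is not a closed condition; it survives in the limit through the uniform bound
   by [c]. *)
have cu x : -1 <= x <= 1 -> c <= u x.
  move=> xI; apply: lim_le => k; have /andP[v1 _] := vb k x xI.
  by have := vu k x xI; rewrite ler_norml => /andP[? ?]; lra.
have I1 : -1 <= (1 : R) <= 1 by lra.
have IN1 : -1 <= (- 1 : R) <= 1 by lra.
have Ua : admissible_obstacle alpha psi U.
  split; last first.
    move=> x; rewrite in_itv/= => xI; apply: lim_le => k.
    have := (va k).2 x; rewrite in_itv/= => /(_ xI) h1.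
    by have := vu k x xI; rewrite ler_norml => /andP[? ?]; lra.
  split=> /=.
  - move=> x; rewrite in_itv/= => /andP[? ?]; apply: (lt_le_trans c0).
    by apply: cu; rewrite !ltW.
  - split; apply: lim_eq => k; have [[_ [e1 e2] _ _] _] := va k; have := eta0 k.
      by have := vu k 1 I1; rewrite e1 distrC; lra.
    by have := vu k (-1) IN1; rewrite e2 distrC; lra.
  - split; apply: lim_eq => k; have [[_ _ [e1 e2] _] _] := va k; have := eta0 k.
      by have := vd k 1 I1; rewrite e1 distrC; lra.
    by have := vd k (-1) IN1; rewrite e2 distrC; lra.
  - move=> x xI; have xI' : -1 <= x <= 1 by move: xI; rewrite in_itv.
    apply: lim_eq => k; have [[_ _ _ ev] _] := va k; have := ev x xI => e1.
    have := vu k x xI'; have := vu k (- x) ltac:(lra).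
    by rewrite e1 !ler_norml => /andP[? ?] /andP[? ?]; apply/andP; split; lra.
exists U => //.
have u0 t : -1 < t < 1 -> 0 < u t.
  by move=> /andP[? ?]; apply: (lt_le_trans c0); apply: cu; rewrite !ltW.
(* The densities are nonnegative and converge almost everywhere, so Fatou gives lower semicontinuity
   of the energy along the sequence. *)
have [] // := @Rfatou _ D
  (fun k t => edensity (v_ k t) (H2_d1 (v_ k) t) (H2_d2 (v_ k) t))
  (fun t => edensity (u t) (d t) (h t)) Emin mD.
- move=> n; apply: measurable_edensity => // t /andP[? ?].
  by apply: (admissible_gt0 alpha0 (va n).1); rewrite !ltW.
- exact: measurable_edensity.
- apply: ae_imply qh => t qh Dt; apply: edensity_cvg; [|exact: vu_cvg|exact: vd_cvg|exact: qh].
  by rewrite gt_eqF//; apply: u0; move: Dt; rewrite /= in_itv.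
- move=> n t Dt; apply/edensity_ge0/ltW/(admissible_gt0 alpha0 (va n).1); exact: inI.
- by move=> t Dt; apply/edensity_ge0/ltW/u0; move: Dt; rewrite /= in_itv.
- by move=> n; exact: (admissible_integrable_edensity alpha0 (va n).1).
- move=> e e0; apply: filterS (eta_cvg e e0) => n en.
  by have := vE n; rewrite /energy; lra.
Qed.

End minimization.

Theorem theorem1p4 (R : realType) (alpha : R) (psi : R -> R) (maxg : R)
  (alpha_gt0 : 0 < alpha)
  (psi_cont : {within `[-1, 1], continuous psi})
  (psi_gt0 : forall x : R, x \in `[-1, 1] -> 0 < psi x)
  (psi_bdry : psi 1 = psi (-1))
  (psi_gt_alpha : alpha < psi (-1))
  (psi_sym : forall x : R, x \in `]-1, 1[ -> psi x = psi (- x))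
  (maxgP : is_max [set g alpha S | S in `[0, alpha]] maxg)
  (inf_lt : (ereal_inf [set Willmore v | v in admissible_obstacle alpha psi]
             < (pi * maxg)%:E)%E) :
  exists u : H2 R, admissible_obstacle alpha psi u /\
    Willmore u =
      ereal_inf [set Willmore v | v in admissible_obstacle alpha psi].
Proof.
have [[S /= SI gS] _] := maxgP.
have Sal : 0 <= S <= alpha by move: SI; rewrite /= in_itv.
set m := ereal_inf _ in inf_lt *.
have pi2 : 0 < pi / 2 :> R by rewrite divr_gt0// pi_gt0.
have WE v : admissible_obstacle alpha psi v -> Willmore v = (pi / 2 * energy v)%:E.
  by move=> [va _]; exact: (WillmoreE alpha_gt0 va).
have m0 : (0 <= m)%E.
  apply: le_ereal_inf_tmp => _ [v va <-].
  by rewrite WE// lee_fin mulr_ge0 ?(ltW pi2)// (energy_ge0 alpha_gt0 va.1).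
(* [inf_lt] excludes the value $+\infty$, which the infimum over an empty class would have. *)
have mfin : m \is a fin_num.
  by rewrite ge0_fin_numE//; exact: lt_trans inf_lt (ltry _).
pose Emin := fine m / (pi / 2).
have mE : m = (pi / 2 * Emin)%:E.
  by rewrite /Emin mulrC divfK ?gt_eqF// fineK.
have [|||u ua uE] := @energy_min_exists R alpha S Emin psi alpha_gt0 Sal.
- move=> v va; rewrite -(ler_pM2l pi2) -lee_fin -mE -WE//.
  by apply: ereal_inf_lbound; exists v.
- move=> e e0.
  have /ereal_inf_lt[_ [v va <-] vm] : (m < (pi / 2 * (Emin + e))%:E)%E.
    by rewrite mE lte_fin ltr_pM2l// ltrDl.
  by exists v => //; move: vm; rewrite WE// lte_fin ltr_pM2l.
(* The identity $\frac{\pi}{2}\cdot2g_\alpha(S)=\pi g_\alpha(S)$ converts the hypothesis on the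
   Willmore infimum into the energy threshold. *)
- rewrite -(ltr_pM2l pi2) -lte_fin -mE gS; apply: (lt_le_trans inf_lt).
  by rewrite lee_fin (_ : pi / 2 * (2 * maxg) = pi * maxg)//; field.
exists u; split => //; apply/eqP; rewrite eq_le; apply/andP; split.
  by rewrite WE// mE lee_fin ler_pM2l.
by apply: ereal_inf_lbound; exists u.
Qed.
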